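(* Let $\mathcal{H}_1$ be a weighted Hardy space in one variable with generating function $G_1(t)=\sum_{n=0}^\infty a_nt^n$ and let $\mathcal{H}_2$ be a weighted Hardy space (in any number of variables) with generating function $G_2(t)=\sum_{n=0}^\infty b_nt^n$. If $\mathcal{H}_1$ and $\mathcal{H}_2$ are strongly related, then there exist $C,c,\gamma\in(0,\infty)$ such that $c\le\frac{b_n}{a_n}\gamma^n\le C$ for all $n$.
   Context: For $d\in\mathbb{N}$ and $r\in(0,\infty]$ let $r\mathbb{B}_d=\{z\in\mathbb{C}^d:|z|<r\}$ and $\overline{r\mathbb{B}_d}=\{z\in\mathbb{C}^d:|z|\le r\}$ (both equal to $\mathbb{C}^d$ if $r=\infty$); $\langle\cdot,\cdot\rangle_d$ is the standard inner product on $\mathbb{C}^d$. A Hilbert function space (RKHS) on a set $X$ is a Hilbert space of complex functions on $X$ all of whose point evaluations are bounded. Generating function: a power series $G(t)=\sum_{n\ge0}a_nt^n$ with $a_0=1$, $a_n>0$ for all $n$, and radius of convergence in $(0,\infty]$. Weighted Hardy space in $d$ variables ($d\in\mathbb N$): a Hilbert function space of holomorphic functions on a ball $r\mathbb{B}_d$, $r\in(0,\infty]$, in which the monomials $z^\alpha$ form a complete orthogonal set of nonzero vectors with $\|z^\alpha\|^2/\alpha!=\|z^\beta\|^2/\beta!$ whenever $|\alpha|=|\beta|$, and $\|\mathbf{1}\|=1$. Equivalently its reproducing kernel is $K(z,w)=G(\langle z,w\rangle_d)$ for a (unique) generating function $G=\sum a_nt^n$ (the generating function of the space), and then $\|z^\alpha\|^{-2}=a_{|\alpha|}\frac{|\alpha|!}{\alpha!}$.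 Convention: every weighted Hardy space is regarded as a space of functions on its natural maximal domain $X$: if $r^2\in(0,\infty]$ is the radius of convergence of $G$, then $X=\mathbb{C}^d$ if $r=\infty$; $X=r\mathbb{B}_d$ if $r<\infty$ and $G(r^2)=\infty$; $X=\overline{r\mathbb{B}_d}$ if $r<\infty$ and $G(r^2)<\infty$ (functions then extend continuously to the closed ball). For Hilbert function spaces $\mathcal{H}_i$ on $X_i$, a weighted composition operator $W_{\lambda,\varphi}:\mathcal{H}_2\to\mathcal{H}_1$ is a bounded operator $f\mapsto\lambda\,(f\circ\varphi)$ with $\varphi:X_1\to X_2$ and $\lambda:X_1\to\mathbb{C}$; it is invertible if it is a bounded bijection (its inverse need not be a weighted composition operator). $\mathcal{H}_1$ is weakly related to $\mathcal{H}_2$ if there is an invertible weighted composition operator $\mathcal{H}_2\to\mathcal{H}_1$. $\mathcal{H}_1$ and $\mathcal{H}_2$ are strongly related if each is weakly related to the other. *)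

(* Defs.v *)
From HB Require Import structures.
From mathcomp Require Import all_boot all_order all_algebra sesquilinear spectral.
From mathcomp Require Import complex.
From mathcomp Require Import all_classical all_reals all_analysis.
Import Order.TTheory GRing.Theory Num.Theory.
Import numFieldNormedType.Exports.

Set Implicit Arguments.
Unset Strict Implicit.
Unset Printing Implicit Defensive.

Local Open Scope classical_set_scope.
Local Open Scope ring_scope.
Local Open Scope complex_scope.

(* The complex numbers are R[i] (R[i]^o where their topology is used), whose order restricts to the order of R on
   real elements and whose norm `|z| is R[i]-valued.  Inner products are
   linear in the first variable and conjugate-linear in the second one. *)

Definition dnorm (R : realType) (V : lmodType R[i])
  (ip : {dot V for (@Num.conj R[i])}) (f : V) : R[i] := sqrtC (ip f f).

(* A Hilbert space of complex functions on X: a vector is identified with the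
   function hfs_eval f : X -> R[i], hence the injectivity of hfs_eval. *)
Record hfs (R : realType) (X : Type) := HFS {
  hfs_sort :> lmodType R[i];
  hfs_ip : {dot hfs_sort for (@Num.conj R[i])};
  hfs_eval : {linear hfs_sort -> (X -> R[i])};
  hfs_eval_inj : injective hfs_eval;
  hfs_complete : forall u : nat -> hfs_sort,
    (forall e : R[i], 0 < e -> exists N, forall m n, (N <= m)%N -> (N <= n)%N ->
       dnorm hfs_ip (u m - u n) < e) ->
    exists l : hfs_sort, forall e : R[i], 0 < e ->
      exists N, forall n, (N <= n)%N -> dnorm hfs_ip (u n - l) < e;
  hfs_eval_bounded : forall x : X, exists M : R, forall f : hfs_sort,
    `|hfs_eval f x| <= M%:C * dnorm hfs_ip f
}.

Definition hfs_norm (R : realType) (X : Type) (H : hfs R X) (f : H) : R[i] :=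
  dnorm (hfs_ip H) f.

Section Relations.
Variables (R : realType) (X1 X2 : Type) (H1 : hfs R X1) (H2 : hfs R X2).

Definition weighted_composition (lam : X1 -> R[i]) (phi : X1 -> X2)
    (W : H2 -> H1) : Prop :=
  (forall f x, hfs_eval H1 (W f) x = lam x * hfs_eval H2 f (phi x)) /\
  (exists M : R, forall f, hfs_norm (W f) <= M%:C * hfs_norm f).

Definition weakly_related : Prop :=
  exists (lam : X1 -> R[i]) (phi : X1 -> X2) (W : H2 -> H1),
    weighted_composition lam phi W /\ bijective W.

End Relations.

Definition strongly_related (R : realType) (X1 X2 : Type)
    (H1 : hfs R X1) (H2 : hfs R X2) : Prop :=
  weakly_related H1 H2 /\ weakly_related H2 H1.

Section WeightedHardy.
Variable R : realType.
Implicit Types (a : nat -> R) (d : nat).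

Definition conv_radius a : \bar R :=
  ereal_sup [set r%:E | r in [set r : R | 0 <= r /\ cvgn (pseries a r)]].

Definition generating_coeffs a : Prop :=
  [/\ a 0%N = 1, forall n, 0 < a n & (0 < conv_radius a)%E].

Definition gen_fun a (t : R[i]) : R[i] :=
  limn (series (fun n => (a n)%:C * t ^+ n) : nat -> R[i]^o).

Definition sqr_enorm d (z : 'rV[R[i]]_d) : R := complex.Re (dotmx z z).

(* The radius r of the ball satisfies r^2 = conv_radius a. *)
Definition hardy_ball a d : set 'rV[R[i]]_d :=
  [set z | ((sqr_enorm z)%:E < conv_radius a)%E].
Arguments hardy_ball a d : clear implicits.

(* The sphere |z| = r is added exactly when r is finite and G(r^2) converges. *)
Definition hardy_domain a d : set 'rV[R[i]]_d :=
  hardy_ball a d `|`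
  [set z | (sqr_enorm z)%:E = conv_radius a /\ cvgn (pseries a (sqr_enorm z))].
Arguments hardy_domain a d : clear implicits.

Definition monomial d (al : {ffun 'I_d -> nat}) (z : 'rV[R[i]]_d) : R[i] :=
  \prod_(i < d) z 0 i ^+ al i.

Definition mdegree d (al : {ffun 'I_d -> nat}) : nat := (\sum_(i < d) al i)%N.

Definition mfactorial d (al : {ffun 'I_d -> nat}) : nat :=
  (\prod_(i < d) (al i)`!)%N.

(* Extension by 0 outside A; only its behaviour on A is ever used. *)
Definition ext0 d (A : set 'rV[R[i]]_d) (f : A -> R[i]) : 'rV[R[i]^o]_d -> R[i]^o :=
  'valL_(0 : R[i]) f.

(* Differentiability is over the scalar field R[i], i.e. it is holomorphy.
   The space lives on its maximal domain, where a function is the continuous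
   extension of its restriction to the open ball. *)
Record weighted_hardy_space a d (H : hfs R (hardy_domain a d)) : Prop := {
  wh_generating : generating_coeffs a;
  wh_holomorphic : forall (f : H) (z : 'rV[R[i]^o]_d), hardy_ball a d z ->
    differentiable (ext0 (hfs_eval H f)) z;
  wh_continuous : forall f : H,
    {within (hardy_domain a d : set 'rV[R[i]^o]_d),
      continuous (ext0 (hfs_eval H f))};
  wh_monomials : exists e : {ffun 'I_d -> nat} -> H,
    (forall al x, hfs_eval H (e al) x = monomial al (val x)) /\
    [/\ forall al, e al != 0,
        forall al be, al != be -> hfs_ip H (e al) (e be) = 0,
        forall f : H, (forall al, hfs_ip H f (e al) = 0) -> f = 0,
        forall al be, mdegree al = mdegree be ->
          hfs_norm (e al) ^+ 2 / (mfactorial al)%:R =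
          hfs_norm (e be) ^+ 2 / (mfactorial be)%:R &
        hfs_norm (e [ffun=> 0%N]) = 1];
  wh_kernel : forall w : hardy_domain a d, exists k : H,
    (forall z, hfs_eval H k z = gen_fun a (dotmx (val z) (val w))) /\
    (forall f : H, hfs_eval H f w = hfs_ip H f k)
}.

End WeightedHardy.

Arguments hardy_ball {R} a d.
Arguments hardy_domain {R} a d.

(* Main.v *)
Require Import Defs.
From mathcomp Require Import all_boot all_order all_algebra.
From mathcomp Require Import complex.
From mathcomp Require Import all_classical all_reals all_analysis.
From mathcomp Require Import ring lra.
Import Order.TTheory GRing.Theory Num.Theory.
Import numFieldNormedType.Exports.

Set Implicit Arguments.
Unset Strict Implicit.
Unset Printing Implicit Defensive.

Local Open Scope classical_set_scope.
Local Open Scope ring_scope.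
Local Open Scope complex_scope.

(** The idea.  In one variable, a weighted composition operator
    $f\mapsto\lambda\,(f\circ\varphi)$ that is invertible and satisfies
    $\varphi(0)=0$ respects the order of vanishing at $0$ and acts on the leading
    coefficient of order $n$ by the factor $\lambda(0)\varphi'(0)^n$.  Comparing
    norms of leading terms, $\|z^n\|^{-2}$ being $a_n$ in the one space and $b_n$
    in the other, gives the conclusion with $\gamma=|\varphi'(0)|^{\pm2}$.  The
    same argument ([iwc_compare]) only needs two such operators, with symbols
    $\Phi_1$ and $\Phi_2$, from one common space into the two given ones, as soon
    as $\Phi_1(0)=\Phi_2(0)$: orders of vanishing are read backwards through the
    first operator, in place of an inverse of $\Phi_1$, which need not exist.

    Let $\varphi$ and $\psi$ be the symbols in the two directions,
    $p=\varphi(0)$ and $q=\psi(0)$.  Rotations preserve all norms, so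
    $\eta'\psi(\eta\varphi(z))$ is an admissible symbol for all unimodular $\eta$
    and $\eta'$, and a common image of the origins exists as soon as
    $|\psi(\eta p)|=|q|$ for some $\eta$.  By the maximum principle and
    connectedness of the circle the only obstruction is
    $|\psi(\eta p)|>|q|$ for all $\eta$; exchanging the spaces, the
    obstruction is in addition that $|\varphi(\eta q)|>|p|$ for all $\eta$
    ([common_or_expanding]).  Both together are impossible
    ([not_both_expanding]): by the minimum principle $\varphi$ and $\psi$ have
    zeros in the discs of radii $|q|$ and $|p|$, so there are points with
    $|\psi(\eta\varphi(z))|\le|z|$, and one with $|z|$ maximal is interior.  After
    a rotation it is a fixed point $s$ of an admissible self-symbol $\Phi$
    with $|\Phi(z)|>|z|$ whenever $|z|>|s|$ near $s$.  But the leading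
    coefficients of order $n$ at $s$ are bounded functionals multiplied by
    $\lambda(s)\Phi'(s)^n$ under a bounded operator, whence $|\Phi'(s)|\le1$
    ([iwc_fixed_deriv]), and then the leading term of $\Phi(z)/z-1$ at $s$
    contradicts extremality ([iwc_fixed_not_extremal]).

    The operators are handled on coefficient sequences: a weighted Hardy space in
    one variable is the space of power series with
    $\sum|c_n|^2/a_n<\infty$ ([axis_series]), and boundedness of the inverse is
    the bounded inverse theorem ([bounded_inverse]).  Symbols map the interior to
    the interior by the maximum principle ([axis_phi_disc]).  The second space
    has one variable too: a symbol from two independent axes into the plane
    cannot separate points the way an invertible operator requires
    ([weakly_related_one_variable]). *)

(** * Complex modulus and complex limits *)

Local Notation Re := complex.Re.
Local Notation Im := complex.Im.
Local Notation cm := ComplexField.Normc.normc.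

Section ComplexModulus.
Variable R : realType.
Implicit Types (z w : R[i]) (x : R).

Lemma cmE z : cm z = Num.sqrt (Re z ^+ 2 + Im z ^+ 2).
Proof. by case: z. Qed.

Lemma cm_ge0 z : 0 <= cm z. Proof. by rewrite cmE sqrtr_ge0. Qed.
Hint Resolve cm_ge0 : core.

Lemma cmsqr z : cm z ^+ 2 = Re z ^+ 2 + Im z ^+ 2.
Proof. by rewrite cmE sqr_sqrtr // addr_ge0 // sqr_ge0. Qed.

Lemma cm0 : cm (0 : R[i]) = 0. Proof. exact: ComplexField.Normc.normc0. Qed.
Lemma cm1 : cm (1 : R[i]) = 1. Proof. exact: ComplexField.Normc.normc1. Qed.

Lemma cm_eq0 z : (cm z == 0) = (z == 0).
Proof.
by apply/eqP/eqP => [/ComplexField.Normc.eq0_normc//|->]; rewrite cm0.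
Qed.

Lemma cm_gt0 z : (0 < cm z) = (z != 0).
Proof. by rewrite lt_neqAle cm_ge0 andbT eq_sym cm_eq0. Qed.

Lemma cmM z w : cm (z * w) = cm z * cm w.
Proof. exact: ComplexField.Normc.normcM. Qed.
Lemma cmV z : cm z^-1 = (cm z)^-1.
Proof. exact: ComplexField.Normc.normcV. Qed.
Lemma cmX z n : cm (z ^+ n) = cm z ^+ n.
Proof. by elim: n => [|n IH]; rewrite ?expr0 ?cm1 // !exprS cmM IH. Qed.
Lemma cmN z : cm (- z) = cm z. Proof. exact: normcN. Qed.
Lemma cmD z w : cm (z + w) <= cm z + cm w. Proof. exact: le_normcD. Qed.
Lemma cmB z w : cm (z - w) <= cm z + cm w.
Proof. by rewrite -[cm w]cmN cmD. Qed.
Lemma cmBC z w : cm (z - w) = cm (w - z). Proof. by rewrite -cmN opprB. Qed.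
Lemma cm_sub z w : cm z - cm w <= cm (z - w).
Proof. by rewrite lerBlDr -{1}(subrK w z) cmD. Qed.

Lemma cm_real x : cm x%:C = `|x|.
Proof. by rewrite cmE /= expr0n /= addr0 sqrtr_sqr. Qed.

Lemma cm_sum I (r : seq I) (P : pred I) (F : I -> R[i]) :
  cm (\sum_(i <- r | P i) F i) <= \sum_(i <- r | P i) cm (F i).
Proof.
elim/big_ind2 : _ => [|a b c d ab cd|//]; first by rewrite cm0.
by apply: (le_trans (cmD _ _)); rewrite lerD.
Qed.

Lemma Re_le_cm z : `|Re z| <= cm z.
Proof. by rewrite cmE -sqrtr_sqr ler_wsqrtr // lerDl sqr_ge0. Qed.
Lemma Im_le_cm z : `|Im z| <= cm z.
Proof. by rewrite cmE -sqrtr_sqr ler_wsqrtr // lerDr sqr_ge0. Qed.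

Lemma ReD z w : Re (z + w) = Re z + Re w. Proof. by case: z; case: w. Qed.
Lemma ImD z w : Im (z + w) = Im z + Im w. Proof. by case: z; case: w. Qed.
Lemma ReM z w : Re (z * w) = Re z * Re w - Im z * Im w.
Proof. by case: z; case: w. Qed.
Lemma ImM z w : Im (z * w) = Re z * Im w + Im z * Re w.
Proof. by case: z => a b; case: w => c d; rewrite /=; ring. Qed.
Lemma ReN z : Re (- z) = - Re z. Proof. by case: z. Qed.
Lemma ImN z : Im (- z) = - Im z. Proof. by case: z. Qed.
Lemma ReV z : Re z^-1 = Re z / (Re z ^+ 2 + Im z ^+ 2). Proof. by case: z. Qed.
Lemma ImV z : Im z^-1 = - (Im z / (Re z ^+ 2 + Im z ^+ 2)).
Proof. by case: z. Qed.
Lemma eq_ReIm z w : Re z = Re w -> Im z = Im w -> z = w.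
Proof. by case: z; case: w => a b c d /= -> ->. Qed.

End ComplexModulus.
#[local] Hint Extern 0 (is_true (0 <= cm _)) => solve [apply: cm_ge0] : core.

Section ComplexLimits.
Variable R : realType.

(** Convergence of complex functions is read off the real and imaginary
    parts, so that the algebra of limits is that of the reals. *)
Definition ctends (T : Type) (F : set_system T) (f : T -> R[i]) (l : R[i]) :=
  (Re (f x) @[x --> F] --> (Re l : R)) /\ (Im (f x) @[x --> F] --> (Im l : R)).

Section Algebra.
Context {T : Type} {F : set_system T} {FF : ProperFilter F}.
Implicit Types (f g : T -> R[i]).

Lemma ctends_cst l : ctends F (fun=> l) l.
Proof. by split; apply: cvg_cst. Qed.

Lemma ctends_ext f g l : f =1 g -> ctends F f l -> ctends F g l.
Proof. by move=> /funext ->. Qed.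

Lemma ctendsD f g l m : ctends F f l -> ctends F g m ->
  ctends F (fun x => f x + g x) (l + m).
Proof.
move=> [f1 f2] [g1 g2]; split.
  by under eq_cvg do rewrite ReD; rewrite ReD; apply: cvgD.
by under eq_cvg do rewrite ImD; rewrite ImD; apply: cvgD.
Qed.

Lemma ctendsN f l : ctends F f l -> ctends F (fun x => - f x) (- l).
Proof.
move=> [f1 f2]; split.
  by under eq_cvg do rewrite ReN; rewrite ReN; apply: cvgN.
by under eq_cvg do rewrite ImN; rewrite ImN; apply: cvgN.
Qed.

Lemma ctendsB f g l m : ctends F f l -> ctends F g m ->
  ctends F (fun x => f x - g x) (l - m).
Proof. by move=> fl gm; apply: ctendsD => //; apply: ctendsN. Qed.

Lemma ctendsM f g l m : ctends F f l -> ctends F g m ->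
  ctends F (fun x => f x * g x) (l * m).
Proof.
move=> [f1 f2] [g1 g2]; split.
  under eq_cvg do rewrite ReM.
  by rewrite ReM; exact: (cvgB (cvgM f1 g1) (cvgM f2 g2)).
under eq_cvg do rewrite ImM.
by rewrite ImM; exact: (cvgD (cvgM f1 g2) (cvgM f2 g1)).
Qed.

Lemma ctendsX f l n : ctends F f l -> ctends F (fun x => f x ^+ n) (l ^+ n).
Proof.
move=> fl; elim: n => [|n IH]; first exact: ctends_cst.
have := ctendsM fl IH; rewrite -exprS; apply: ctends_ext => x.
by rewrite exprS.
Qed.

Lemma ctendsV f l : l != 0 -> ctends F f l ->
  ctends F (fun x => (f x)^-1) l^-1.
Proof.
move=> l0 [f1 f2].
have h : (Re (f x) ^+ 2 + Im (f x) ^+ 2) @[x --> F]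
   --> (Re l ^+ 2 + Im l ^+ 2 : R).
  by exact: (cvgD (cvgM f1 f1) (cvgM f2 f2)).
have l1 : Re l ^+ 2 + Im l ^+ 2 != 0 :> R.
  by rewrite -cmsqr sqrf_eq0 cm_eq0.
split.
  under eq_cvg do rewrite ReV.
  by rewrite ReV; exact: (cvgM f1 (cvgV l1 h)).
under eq_cvg do rewrite ImV.
by rewrite ImV; exact: (cvgN (cvgM f2 (cvgV l1 h))).
Qed.

Lemma ctends_cm f l : ctends F f l -> cm (f x) @[x --> F] --> (cm l : R).
Proof.
move=> [f1 f2].
under eq_cvg do rewrite cmE.
rewrite cmE; apply: (@cvg_comp _ _ _ _ (@Num.sqrt R)); last exact: sqrt_continuous.
by exact: (cvgD (cvgM f1 f1) (cvgM f2 f2)).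
Qed.

Lemma ctends_eps f l : ctends F f l <->
  (forall e : R, 0 < e -> \forall x \near F, cm (f x - l) < e).
Proof.
split=> [fl e e0|fl].
  have := ctends_cm (ctendsB fl (ctends_cst l)); rewrite subrr cm0 => h.
  exact: (cvgr_lt (0 : R) h e e0).
split; apply/cvgrPdist_lt => e e0; near=> x;
  rewrite distrC -?ReN -?ImN -?ReD -?ImD.
  by apply: (le_lt_trans (Re_le_cm _)); near: x; apply: fl.
by apply: (le_lt_trans (Im_le_cm _)); near: x; apply: fl.
Unshelve. all: by end_near. Qed.

Lemma ctends_unique f l m : ctends F f l -> ctends F f m -> l = m.
Proof.
move=> [f1 f2] [g1 g2].
apply: eq_ReIm; first exact: (cvg_unique _ f1 g1).
exact: (cvg_unique _ f2 g2).
Qed.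

Lemma ctends_near f g l : (\forall x \near F, f x = g x) ->
  ctends F f l -> ctends F g l.
Proof.
move=> fg /ctends_eps fl; apply/ctends_eps => e e0.
by apply: filterS2 fg (fl e e0) => x ->.
Qed.

Lemma ctends_neq0 f l : l != 0 -> ctends F f l -> \forall x \near F, f x != 0.
Proof.
move=> l0 /ctends_eps fl; have := fl (cm l).
rewrite cm_gt0 => /(_ l0); apply: filterS => x; rewrite cmBC => h.
by apply/eqP => f0; move: h; rewrite f0 subr0 ltxx.
Qed.

Lemma ctends_le f l (B : R) : (\forall x \near F, cm (f x) <= B) ->
  ctends F f l -> cm l <= B.
Proof.
move=> fB /ctends_cm fl; rewrite -(cvg_lim _ fl) //.
by apply: limr_le fB; apply/cvg_ex; exists (cm l).
Qed.

End Algebra.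
End ComplexLimits.

(** * Power series and orders of vanishing *)

Section PowerSeries.
Variable R : realType.
Implicit Types (c g : nat -> R[i]) (z q w : R[i]) (r K : R).

(** Neighbourhoods in terms of the real-valued modulus, so that radii are real. *)
Definition cnbhs z : set_system R[i] :=
  filter_from [set e : R | 0 < e] (fun e => [set w | cm (w - z) < e]).

Global Instance cnbhs_filter z : ProperFilter (cnbhs z).
Proof.
apply: filter_from_proper; last first.
  by move=> e /= e0; exists z; rewrite /= subrr cm0.
apply: filter_from_filter; first by exists 1 => /=.
move=> e f /= e0 f0; exists (Num.min e f); first by rewrite /= lt_min e0.
by move=> w /=; rewrite lt_min => /andP[].
Qed.

Lemma near_ball z (e : R) : 0 < e -> \forall w \near cnbhs z, cm (w - z) < e.
Proof. by move=> e0; exists e. Qed.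

Lemma near_cm_lt z r : cm z < r -> \forall w \near cnbhs z, cm w < r.
Proof.
move=> zr; have := @near_ball z (r - cm z); rewrite subr_gt0 => /(_ zr).
by apply: filterS => w h; have := cm_sub w z; lra.
Qed.

Lemma ctends_id z : ctends (cnbhs z) id z.
Proof. by apply/ctends_eps => e; exact: near_ball. Qed.

Lemma ctends_comp {T : Type} {F : set_system T} {FF : ProperFilter F}
    (f : T -> R[i]) z (P : set R[i]) :
  ctends F f z -> (\forall w \near cnbhs z, P w) -> \forall x \near F, P (f x).
Proof.
by move=> /ctends_eps fz [e /= e0 eP]; apply: filterS (fz _ e0) => x; apply: eP.
Qed.

Lemma ctends_compose {T : Type} {F : set_system T} {FF : ProperFilter F}
    (f : T -> R[i]) (g : R[i] -> R[i]) z l :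
  ctends F f z -> ctends (cnbhs z) g l -> ctends F (g \o f) l.
Proof.
move=> fz /ctends_eps gl; apply/ctends_eps => e e0.
exact: (ctends_comp fz (gl e e0)).
Qed.

Definition psum c z (N : nat) := \sum_(n < N) c n * z ^+ n.

(** A total function, given by the limits of the real and imaginary parts; it is
    the sum of the series wherever that converges. *)
Definition ps c z : R[i] :=
  Complex (limn (fun N => Re (psum c z N))) (limn (fun N => Im (psum c z N))).

Definition pbound c r K := forall n, cm (c n) * r ^+ n <= K.

Lemma psum0 c z : psum c z 0 = 0. Proof. by rewrite /psum big_ord0. Qed.
Lemma psumS c z N : psum c z N.+1 = psum c z N + c N * z ^+ N.
Proof. by rewrite /psum big_ord_recr. Qed.

Lemma ps_unique c z l : ctends \oo (psum c z) l -> ps c z = l.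
Proof.
move=> [h1 h2]; apply: eq_ReIm => /=; first exact: (cvg_lim _ h1).
exact: (cvg_lim _ h2).
Qed.

Lemma geometric_dominated_cvg (u : nat -> R) K k : 0 <= k < 1 ->
  (forall n, `|u n| <= K * k ^+ n) -> cvgn (series u).
Proof.
move=> /andP[k0 k1] uK; apply: normed_cvg.
apply: (@series_le_cvg _ _ (geometric K k)).
- by move=> n /=; exact: normr_ge0.
- by move=> n /=; apply: le_trans (uK n); exact: normr_ge0.
- by move=> n /=; exact: uK.
- by apply: is_cvg_geometric_series; rewrite ger0_norm.
Qed.

Lemma pbound_term c r K z n : pbound c r K -> cm z < r ->
  cm (c n * z ^+ n) <= K * (cm z / r) ^+ n.
Proof.
move=> cK zr; have r0 := le_lt_trans (cm_ge0 z) zr.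
rewrite cmM cmX expr_div_n mulrA ler_pdivlMr ?exprn_gt0 //.
by rewrite mulrAC ler_wpM2r ?exprn_ge0.
Qed.

Lemma ratio_lt1 z r : cm z < r -> 0 <= cm z / r < 1.
Proof.
move=> zr; have r0 := le_lt_trans (cm_ge0 z) zr.
by rewrite divr_ge0 ?(ltW r0) //= ltr_pdivrMr // mul1r.
Qed.

Lemma ps_cvg c r K z : pbound c r K -> cm z < r ->
  ctends \oo (psum c z) (ps c z).
Proof.
move=> cK zr; have k := ratio_lt1 zr.
have part (p : R[i] -> R) : p 0 = 0 -> {morph p : x y / x + y} ->
    (forall x, `|p x| <= cm x) -> cvgn (fun N => p (psum c z N)).
  move=> p0 pD pcm.
  have -> : (fun N => p (psum c z N)) = series (fun n => p (c n * z ^+ n)).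
    apply/funext => N; rewrite /series /= /psum (big_morph p pD p0).
    by rewrite big_mkord.
  apply: (@geometric_dominated_cvg _ K _ k) => n.
  exact: (le_trans (pcm _) (pbound_term n cK zr)).
split; apply: part => //.
- exact: ReD.
- exact: Re_le_cm.
- exact: ImD.
- exact: Im_le_cm.
Qed.

Lemma pbound_ge0 c r K : pbound c r K -> 0 <= K.
Proof.
by move=> /(_ 0%N); rewrite expr0 mulr1; apply: le_trans.
Qed.

Lemma ps_le c r K z : pbound c r K -> cm z < r ->
  cm (ps c z) <= K * r / (r - cm z).
Proof.
move=> cK zr; have r0 := le_lt_trans (cm_ge0 z) zr.
have /andP[k0 k1] := ratio_lt1 zr.
have K0 := pbound_ge0 cK.
apply: (ctends_le _ (ps_cvg cK zr)); apply: nearW => N.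
apply: (le_trans (cm_sum _ _ _)).
apply: (@le_trans _ _ (\sum_(n < N) K * (cm z / r) ^+ n)).
  by apply: ler_sum => n _; exact: pbound_term.
rewrite -mulr_sumr -mulrA ler_wpM2l //.
have -> : r / (r - cm z) = (1 - cm z / r)^-1.
  by field; rewrite ?gt_eqF // subr_gt0.
rewrite -[leRHS]mul1r ler_pdivlMr ?subr_gt0 // mulrC.
by have h := subrX1 (cm z / r) N; have kN := exprn_ge0 N k0; lra.
Qed.

Lemma psB c c' r K K' y z : pbound c r K -> pbound c' r K' -> cm z < r ->
  ps (fun n => c n - y * c' n) z = ps c z - y * ps c' z.
Proof.
move=> cK cK' zr; apply: ps_unique.
apply: (ctends_ext _ (ctendsB (ps_cvg cK zr)
  (ctendsM (ctends_cst y) (ps_cvg cK' zr)))) => N; rewrite /psum mulr_sumr -sumrB.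
by apply: eq_bigr => n _; ring.
Qed.

Lemma pboundB c c' r K K' y : 0 <= r -> pbound c r K -> pbound c' r K' ->
  pbound (fun n => c n - y * c' n) r (K + cm y * K').
Proof.
move=> r0 cK cK' n; apply: (@le_trans _ _ ((cm (c n) + cm (y * c' n)) * r ^+ n)).
  by rewrite ler_wpM2r ?exprn_ge0 // cmB.
by rewrite mulrDl lerD // cmM -mulrA ler_wpM2l.
Qed.

Definition pshift c n := if n is m.+1 then c m else 0.

Lemma pbound_shift c r K : 0 <= r -> pbound c r K -> pbound (pshift c) r (r * K).
Proof.
move=> r0 cK [|n]; rewrite /pshift.
  by rewrite cm0 mul0r mulr_ge0 // (pbound_ge0 cK).
by rewrite exprS mulrCA ler_wpM2l.
Qed.

Lemma ctends_shift (u : nat -> R[i]) l :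
  ctends \oo u l -> ctends \oo (fun n => u n.+1) l.
Proof.
move=> [u1 u2]; split.
  by have := @cvg_shiftS _ (fun n => Re (u n)) (nbhs (Re l)) => ->.
by have := @cvg_shiftS _ (fun n => Im (u n)) (nbhs (Im l)) => ->.
Qed.

Lemma ps_shift c r K z : pbound c r K -> cm z < r ->
  ps (pshift c) z = z * ps c z.
Proof.
move=> cK zr; have r0 := ltW (le_lt_trans (cm_ge0 z) zr).
pose proof (ctends_shift (ps_cvg (pbound_shift r0 cK) zr)) as h1.
pose proof (ctendsM (ctends_cst z) (ps_cvg cK zr)) as h2.
apply: (ctends_unique h1); apply: (ctends_ext _ h2) => N.
rewrite /psum big_ord_recl /= mul0r add0r mulr_sumr.
by apply: eq_bigr => n _; rewrite /bump /= exprS; ring.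
Qed.

Lemma ps_recl c r K z : pbound c r K -> cm z < r ->
  ps c z = c 0%N + z * ps (fun n => c n.+1) z.
Proof.
move=> cK zr; have r0 := le_lt_trans (cm_ge0 z) zr.
have cK' : pbound (fun n => c n.+1) r (K / r).
  by move=> n; rewrite ler_pdivlMr // -mulrA -exprSr.
pose proof (ctends_shift (ps_cvg cK zr)) as h1.
pose proof (ctendsD (ctends_cst (c 0%N))
  (ctendsM (ctends_cst z) (ps_cvg cK' zr))) as h2.
apply: (ctends_unique h1); apply: (ctends_ext _ h2) => N.
rewrite /psum big_ord_recl /= expr0 mulr1 mulr_sumr; congr (_ + _).
by apply: eq_bigr => n _; rewrite /bump /= exprS; ring.
Qed.

Lemma ps_poly (p : {poly R[i]}) z : ps (fun n => p`_n) z = p.[z].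
Proof.
apply: ps_unique; apply: (ctends_near (f := fun=> p.[z])).
  exists (size p) => // N /= pN; rewrite /psum horner_coef.
  by rewrite -!(big_mkord xpredT (fun n => p`_n * z ^+ n));
    rewrite (big_cat_nat (leq0n _) pN) /= [X in _ + X]big1_seq ?addr0 // => i;
    rewrite mem_index_iota => /and3P[_ pi _]; rewrite nth_default ?mul0r.
exact: ctends_cst.
Qed.

(** Dividing $f(z)-f(q)$ by $z-q$ stays within power series of the same radius:
    the new coefficients are the tails $\sum_n c_{n+j+1}q^n$. *)
Lemma ps_ddiff c r K q : pbound c r K -> cm q < r ->
  exists2 g, pbound g r (K / (r - cm q)) &
    forall z, cm z < r -> ps c z = ps c q + (z - q) * ps g z.
Proof.
move=> cK qr; have r0 := le_lt_trans (cm_ge0 q) qr.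
pose t j := ps (fun n => c (n + j)%N) q.
have tK j : pbound (fun n => c (n + j)%N) r (K / r ^+ j).
  by move=> n; rewrite ler_pdivlMr ?exprn_gt0 // -mulrA -exprD.
have tS j : t j = c j + q * t j.+1.
  have -> : t j.+1 = ps (fun n => c (n.+1 + j)%N) q.
    by congr (ps _ q); apply/funext => n; rewrite addSnnS.
  exact: (ps_recl (tK j) qr).
have tle j : cm (t j) * r ^+ j <= K * r / (r - cm q).
  rewrite -ler_pdivlMr ?exprn_gt0 //.
  have -> : K * r / (r - cm q) / r ^+ j = K / r ^+ j * r / (r - cm q) by ring.
  exact: ps_le (tK j) qr.
have gK : pbound (fun j => t j.+1) r (K / (r - cm q)).
  move=> j; have := tle j.+1.
  by rewrite exprSr mulrA [K * r / _]mulrAC ler_pM2r.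
exists (fun j => t j.+1) => // z zr.
have sumE N : psum (fun j => t j.+1) z N * (z - q) =
    psum c z N - t 0%N + t N * z ^+ N.
  elim: N => [|N IH]; first by rewrite !psum0; ring.
  rewrite !psumS mulrDl IH (tS N) exprS; ring.
have rem0 : ctends \oo (fun N => t N * z ^+ N) 0.
  have tb : pbound t r (K * r / (r - cm q)) by move=> j; exact: tle.
  have /andP[k0 k1] := ratio_lt1 zr.
  apply/ctends_eps => e e0.
  have : (K * r / (r - cm q)) * (cm z / r) ^+ N @[N --> \oo] --> 0.
    rewrite -[X in _ --> X](mulr0 (K * r / (r - cm q))).
    by apply: cvgM; [exact: cvg_cst|apply: cvg_expr; rewrite ger0_norm].
  move/cvgr_lt => /(_ e e0); apply: filterS => N; rewrite subr0.
  exact: le_lt_trans (pbound_term N tb zr).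
pose proof (ctendsM (ps_cvg gK zr) (ctends_cst (z - q))) as h1.
pose proof (ctendsD (ctendsB (ps_cvg cK zr) (ctends_cst (t 0%N))) rem0) as h2.
have -> : ps c q = t 0%N.
  by rewrite /t; congr ps; apply/funext => n; rewrite addn0.
have -> : (z - q) * ps (fun j => t j.+1) z = ps c z - t 0%N + 0.
  by rewrite mulrC; apply: (ctends_unique h1); apply: (ctends_ext _ h2) => N.
by ring.
Qed.

Lemma ps_continuous c r K q : pbound c r K -> cm q < r ->
  ctends (cnbhs q) (ps c) (ps c q).
Proof.
move=> cK qr; have [g gK gE] := ps_ddiff cK qr.
pose s := (cm q + r) / 2; have qs : cm q < s by rewrite /s; lra.
have sr : s < r by rewrite /s; lra.
have r0 := le_lt_trans (cm_ge0 q) qr.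
pose B := K / (r - cm q) * r / (r - s).
have B0 : 0 <= B.
  by rewrite /B !mulr_ge0 ?invr_ge0 ?(pbound_ge0 cK) // ?subr_ge0 ltW.
apply/ctends_eps => e e0.
have eB : 0 < e / (B + 1) by rewrite divr_gt0 // ltr_wpDl.
apply: filterS2 (near_cm_lt qs) (near_ball q eB) => z zs zq.
have zr := lt_trans zs sr.
rewrite (gE z zr) addrC addKr cmM.
have gB : cm (ps g z) <= B.
  apply: (le_trans (ps_le gK zr)); rewrite /B ler_wpM2l //.
    by rewrite mulr_ge0 ?(pbound_ge0 gK) // ltW.
  by rewrite lef_pV2 ?posrE ?subr_gt0 // lerD2l lerN2 ltW.
apply: (@le_lt_trans _ _ (cm (z - q) * B)); first by rewrite ler_wpM2l.
apply: (@le_lt_trans _ _ (cm (z - q) * (B + 1))).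
  by rewrite ler_wpM2l // lerDl.
by rewrite -ltr_pdivlMr // ltr_wpDl.
Qed.

(** Repeated division by $z-q$, which stops at the first cofactor that does not
    vanish at $q$. *)
Lemma ps_order c r K q n : pbound c r K -> cm q < r ->
  (exists k g K', [/\ (k < n)%N, pbound g r K', ps g q != 0 &
     forall z, cm z < r -> ps c z = (z - q) ^+ k * ps g z]) \/
  (exists2 g, pbound g r (K / (r - cm q) ^+ n) &
     forall z, cm z < r -> ps c z = (z - q) ^+ n * ps g z).
Proof.
move=> cK qr; elim: n => [|n [[k [g [K' [kn gK gq gE]]]]|[g gK gE]]].
- by right; exists c => [|z _]; rewrite ?expr0 ?divr1 ?mul1r.
- by left; exists k, g, K'; split => //; rewrite ltnS ltnW.
- have [g0|g0] := eqVneq (ps g q) 0; last first.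
    by left; exists n, g, (K / (r - cm q) ^+ n).
  right; have [h hK hE] := ps_ddiff gK qr; exists h.
    by move=> j; rewrite exprSr invfM mulrA.
  by move=> z zr; rewrite gE // hE // g0 add0r mulrA -exprSr.
Qed.

(** Without finite order the series vanishes near $q$: the cofactors grow at
    most geometrically, at rate $1/(r-|q|)$. *)
Lemma ps_order_infinite c r K q : pbound c r K -> cm q < r ->
  (exists k g K', [/\ pbound g r K', ps g q != 0 &
     forall z, cm z < r -> ps c z = (z - q) ^+ k * ps g z]) \/
  (forall z, cm (z - q) < r - cm q -> ps c z = 0).
Proof.
move=> cK qr.
have [[k [g [K' h]]]|nofin] := pselect (exists k g K', [/\ pbound g r K', ps g q != 0 &
     forall z, cm z < r -> ps c z = (z - q) ^+ k * ps g z]).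
  by left; exists k, g, K'.
right=> z zq; have zr : cm z < r by have := cm_sub z q; lra.
have r0 := le_lt_trans (cm_ge0 q) qr.
apply/eqP; rewrite -cm_eq0 eq_le cm_ge0 andbT.
set k := cm (z - q) / (r - cm q).
have /andP[k0 k1] : 0 <= k < 1 by apply: ratio_lt1.
have le n : cm (ps c z) <= (K * r / (r - cm z)) * k ^+ n.
  have [[j [g [K' [jn gK gq gE]]]]|[g gK gE]] := ps_order n cK qr.
    by exfalso; apply: nofin; exists j, g, K'.
  rewrite gE // cmM cmX mulrC.
  apply: (@le_trans _ _ (K / (r - cm q) ^+ n * r / (r - cm z) * cm (z - q) ^+ n)).
    by rewrite ler_wpM2r ?exprn_ge0 // ps_le.
  by rewrite /k expr_div_n le_eqVlt; apply/orP; left; apply/eqP; ring.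
have : (K * r / (r - cm z)) * k ^+ N @[N --> \oo] --> 0.
  rewrite -[X in _ --> X](mulr0 (K * r / (r - cm z))).
  by apply: cvgM; [exact: cvg_cst|apply: cvg_expr; rewrite ger0_norm].
move=> h; rewrite -(cvg_lim _ h) //; apply: limr_ge; first by apply/cvg_ex; exists 0.
by apply: nearW => N.
Qed.

End PowerSeries.

(** * Weighted composition operators on coefficient sequences *)

Section LocalExpansions.
Variable R : realType.
Implicit Types (z w q : R[i]) (c : nat -> R[i]) (F G f : R[i] -> R[i]).

Lemma near_cmp z (P : set R[i]) : (\forall w \near cnbhs z, P w) ->
  exists2 e : R, 0 < e & forall w, cm (w - z) < e -> P w.
Proof. by move=> [e /= e0 eP]; exists e. Qed.

Lemma ctends_punctured_unique F G z l m :
  (\forall w \near cnbhs z, w != z -> F w = G w) ->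
  ctends (cnbhs z) F l -> ctends (cnbhs z) G m -> l = m.
Proof.
move=> FG /ctends_eps Fl /ctends_eps Gm; apply/eqP; rewrite -subr_eq0 -cm_eq0.
rewrite eq_le cm_ge0 andbT leNgt; apply/negP => h.
have h2 : 0 < cm (l - m) / 2 by rewrite divr_gt0.
have [e e0 eP] := near_cmp (filterI FG (filterI (Fl _ h2) (Gm _ h2))).
have ec : cm (e / 2)%:C < e by rewrite cm_real ger0_norm ?ltW ?divr_gt0 //; lra.
have /= [] := eP (z + (e / 2)%:C); first by rewrite addrC addKr.
have zn : z + (e / 2)%:C != z.
  by rewrite -subr_eq0 addrC addKr -cm_gt0 cm_real normr_gt0 gt_eqF ?divr_gt0.
move=> /(_ zn) -> []; rewrite cmBC => h3 h4.
have := cmD (l - G (z + (e / 2)%:C)) (G (z + (e / 2)%:C) - m).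
rewrite addrA subrK; lra.
Qed.

Lemma ps_at0 c r K : 0 < r -> pbound c r K -> ps c 0 = c 0%N.
Proof. by move=> r0 cK; rewrite (ps_recl cK) ?mul0r ?addr0 // cm0. Qed.

(** The expansion is only required off the origin, where it can be divided by
    powers of $z$; continuity recovers the value at the origin. *)
Lemma ps_lead_coef c r K n G l : 0 < r -> pbound c r K ->
  (\forall z \near cnbhs 0, z != 0 -> ps c z = z ^+ n * G z) ->
  ctends (cnbhs 0) G l -> c n = l.
Proof.
move=> r0; elim: n c K => [|n IH] c K cK cG Gl.
  rewrite -(ps_at0 r0 cK); apply: (ctends_punctured_unique (F := ps c) _ _ Gl).
    by apply: filterS cG => z h /h ->; rewrite expr0 mul1r.
  by apply: ps_continuous cK _; rewrite cm0.
have c0 : c 0%N = 0.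
  rewrite -(ps_at0 r0 cK); apply: (ctends_punctured_unique cG).
    by apply: ps_continuous cK _; rewrite cm0.
  have : ctends (cnbhs 0) (fun z => z ^+ n.+1 * G z) (0 ^+ n.+1 * l).
    by apply: ctendsM Gl; apply/ctendsX/ctends_id.
  by rewrite expr0n mul0r.
have cK' : pbound (fun n => c n.+1) r (K / r).
  by move=> j; rewrite ler_pdivlMr // -mulrA -exprSr.
apply: (IH (fun n => c n.+1) _ cK') => //.
have rn : cm (0 : R[i]) < r by rewrite cm0.
apply: filterS2 cG (near_cm_lt rn) => z h zr z0; apply: (mulfI z0).
by rewrite mulrA -exprS -h // (ps_recl cK zr) c0 add0r.
Qed.

(** [f] has complex derivative [d] at [z]; the difference quotient is carried
    explicitly because only products of such expansions are ever formed. *)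
Definition cderiv f z d :=
  exists2 X, ctends (cnbhs z) X d &
    \forall w \near cnbhs z, f w = f z + (w - z) * X w.

Lemma cderiv_continuous f z d : cderiv f z d -> ctends (cnbhs z) f (f z).
Proof.
move=> [X Xd fX].
have h : ctends (cnbhs z) (fun w => f z + (w - z) * X w) (f z + (z - z) * d).
  apply: ctendsD; first exact: ctends_cst.
  by apply: ctendsM Xd; apply: ctendsB (ctends_id z) (ctends_cst z).
rewrite subrr mul0r addr0 in h.
by apply: ctends_near h; apply: filterS fX => w ->.
Qed.

End LocalExpansions.

Section WeightedCompositions.
Variable R : realType.
Implicit Types (a b y : nat -> R) (c : nat -> R[i]) (lam phi : R[i] -> R[i]).
Implicit Types (z w q e : R[i]) (r K M B : R).

(** The bound $\|c\|\le B$ in the sequence space with $\|z^n\|^{-2}=a_n$. *)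
Definition l2_le a c B :=
  0 <= B /\ forall N, \sum_(n < N) cm (c n) ^+ 2 / a n <= B ^+ 2.

(** The disc where $|z|^2$ is less than the radius of convergence of $\sum a_nt^n$
    (see [disc_conv_radius]), in a form that bounds coefficients at once. *)
Definition disc a z :=
  exists r K, cm z < r /\ forall n, a n * (r ^+ n) ^+ 2 <= K.

(** Invertible weighted composition operators between weighted sequence
    spaces, as relations: invertibility and boundedness, both ways, are the
    existence of images and preimages of controlled norm. *)
Record iwc a b lam phi M : Prop := {
  iwc_ge0 : 0 <= M;
  iwc_disc : forall z, disc a z -> disc b (phi z);
  iwc_fwd : forall c B, l2_le b c B -> exists2 c', l2_le a c' (M * B) &
    forall z, disc a z -> ps c' z = lam z * ps c (phi z);
  iwc_bwd : forall c' B, l2_le a c' B -> exists2 c, l2_le b c (M * B) &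
    forall z, disc a z -> ps c' z = lam z * ps c (phi z) }.

Lemma disc_le a z w : cm w <= cm z -> disc a z -> disc a w.
Proof.
by move=> wz [r [K [zr aK]]]; exists r, K; split => //; apply: le_lt_trans zr.
Qed.

Lemma disc_near a z : disc a z -> \forall w \near cnbhs z, disc a w.
Proof.
move=> [r [K [zr aK]]]; apply: filterS (near_cm_lt zr) => w wr.
by exists r, K.
Qed.

Lemma l2_le_coef a c B n : (forall n, 0 < a n) -> l2_le a c B ->
  cm (c n) ^+ 2 <= B ^+ 2 * a n.
Proof.
move=> a0 [_ /(_ n.+1)]; rewrite big_ord_recr /= => h.
rewrite -ler_pdivrMr //; apply: le_trans h; rewrite lerDr.
by apply: sumr_ge0 => i _; rewrite divr_ge0 ?sqr_ge0 // ltW.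
Qed.

Lemma l2_le_pbound a c B r K : (forall n, 0 < a n) -> 0 <= r -> l2_le a c B ->
  (forall n, a n * (r ^+ n) ^+ 2 <= K) -> pbound c r (B * Num.sqrt K).
Proof.
move=> a0 r0 cB aK n.
have K0 : 0 <= K.
  by apply: le_trans (aK 0%N); rewrite expr0 expr1n mulr1 ltW.
have B0 := cB.1.
rewrite -(@ler_pXn2r _ 2) ?nnegrE ?mulr_ge0 ?exprn_ge0 ?sqrtr_ge0 //.
rewrite !exprMn sqr_sqrtr //.
apply: (@le_trans _ _ (B ^+ 2 * a n * (r ^+ n) ^+ 2)).
  by rewrite ler_wpM2r ?sqr_ge0 // l2_le_coef.
by rewrite -mulrA ler_wpM2l ?sqr_ge0.
Qed.

Lemma disc_pbound a z : (forall n, 0 < a n) -> disc a z ->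
  exists r, [/\ cm z < r, forall w, cm w < r -> disc a w &
    exists K, forall c B, l2_le a c B -> pbound c r (B * K)].
Proof.
move=> a0 [r [K [zr aK]]]; exists r; split => //.
  by move=> w wr; exists r, K.
exists (Num.sqrt K) => c B cB; apply: l2_le_pbound aK => //.
exact/ltW/(le_lt_trans _ zr).
Qed.

Lemma l2_le_monomial a n : (forall n, 0 < a n) ->
  l2_le a (fun k => ('X^n : {poly R[i]})`_k) (Num.sqrt (a n)^-1).
Proof.
move=> a0; split => [|N]; first exact: sqrtr_ge0.
rewrite sqr_sqrtr ?invr_ge0 ?(ltW (a0 n)) //.
have t k : cm ('X^n : {poly R[i]})`_k ^+ 2 / a k = if k == n then (a k)^-1 else 0.
  rewrite coefXn; case: eqP => _; first by rewrite cm1 expr1n mul1r.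
  by rewrite cm0 expr0n mul0r.
under eq_bigr do rewrite t.
rewrite -big_mkcond /=.
have [nN|nN] := ltnP n N.
  by rewrite (big_pred1 (Ordinal nN)) // => i; rewrite -val_eqE.
rewrite big1 ?invr_ge0 ?(ltW (a0 n)) // => i /eqP h.
by have := ltn_ord i; rewrite h ltnNge nN.
Qed.

Lemma l2_le_poly a (p : {poly R[i]}) : (forall n, 0 < a n) ->
  exists B, l2_le a (fun k => p`_k) B.
Proof.
move=> a0; pose S := \sum_(k < size p) cm p`_k ^+ 2 / a k.
have t0 k : 0 <= cm p`_k ^+ 2 / a k by rewrite divr_ge0 ?sqr_ge0 // ltW.
have S0 : 0 <= S by apply: sumr_ge0.
exists (1 + S); split => [|N]; first by rewrite addr_ge0.
have h : \sum_(k < N) cm p`_k ^+ 2 / a k <= S.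
  have [Np|pN] := leqP N (size p).
    rewrite /S -!(big_mkord xpredT (fun k => cm p`_k ^+ 2 / a k)).
    rewrite [leRHS](big_cat_nat (leq0n _) Np) //= lerDl.
    exact: sumr_ge0.
  rewrite /S -!(big_mkord xpredT (fun k => cm p`_k ^+ 2 / a k)).
  rewrite (big_cat_nat (leq0n _) (ltnW pN)) //= [X in _ + X]big1_seq ?addr0 //.
  move=> k; rewrite mem_index_iota => /and3P[_ pk _].
  by rewrite nth_default // cm0 expr0n mul0r.
by apply: (le_trans h); nra.
Qed.

Lemma iwc_comp a b y l1 f1 M1 l2 f2 M2 :
  iwc a b l1 f1 M1 -> iwc b y l2 f2 M2 ->
  iwc a y (fun z => l1 z * l2 (f1 z)) (f2 \o f1) (M1 * M2).
Proof.
move=> h1 h2; split.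
- by rewrite mulr_ge0 ?(iwc_ge0 h1) ?(iwc_ge0 h2).
- by move=> z az; apply/(iwc_disc h2)/(iwc_disc h1).
- move=> c B /(iwc_fwd h2)[c1 cB1 E1]; have [c2 cB2 E2] := iwc_fwd h1 cB1.
  exists c2; first by rewrite -mulrA.
  by move=> z az; rewrite (E2 z az) (E1 _ (iwc_disc h1 az)) mulrA.
- move=> c B /(iwc_bwd h1)[c1 cB1 E1]; have [c2 cB2 E2] := iwc_bwd h2 cB1.
  exists c2; first by rewrite [M1 * M2]mulrC -mulrA.
  by move=> z az; rewrite (E1 z az) (E2 _ (iwc_disc h1 az)) mulrA.
Qed.

Lemma iwc_rot a e : cm e = 1 -> iwc a a (fun=> 1) (fun z => e * z) 1.
Proof.
move=> e1.
have rot f c B : cm f = 1 -> l2_le a c B -> l2_le a (fun n => c n * f ^+ n) (1 * B).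
  move=> f1 [B0 cB]; split; rewrite mul1r // => N; apply: le_trans (cB N).
  by apply: ler_sum => n _; rewrite cmM cmX f1 expr1n mulr1.
have e0 : e != 0 by rewrite -cm_gt0 e1.
have psE f c z : ps (fun n => c n * f ^+ n) z = ps c (f * z).
  rewrite /ps; congr (Complex (limn _) (limn _)); apply/funext => N;
    by congr (_ _); apply: eq_bigr => n _; rewrite exprMn mulrA.
split => //.
- by move=> z; apply: disc_le; rewrite cmM e1 mul1r.
- move=> c B cB; exists (fun n => c n * e ^+ n); first exact: rot.
  by move=> z _; rewrite psE mul1r.
- move=> c B cB; exists (fun n => c n * e^-1 ^+ n).
    by apply: rot cB; rewrite cmV e1 invr1.
  by move=> z _; rewrite mul1r (psE e^-1) (mulKf e0).
Qed.

Section Local.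
Variables (a b : nat -> R) (a0 : forall n, 0 < a n) (b0 : forall n, 0 < b n).
Variables (lam phi : R[i] -> R[i]) (M : R) (h : iwc a b lam phi M).

Lemma iwc_lam_neq0 z : disc a z -> lam z != 0.
Proof.
move=> az; have [B /(iwc_bwd h)[c _ /(_ z az)]] := l2_le_poly 1 a0.
rewrite ps_poly hornerC => E; apply/eqP => l0.
by move/eqP: E; rewrite l0 mul0r oner_eq0.
Qed.

Lemma iwc_lam_continuous z : disc a z -> ctends (cnbhs z) lam (lam z).
Proof.
move=> az; have [B /(iwc_fwd h)[c cB cE]] := l2_le_poly 1 b0.
have [r [zr rD [K cK]]] := disc_pbound a0 az.
have lE w : disc a w -> ps c w = lam w.
  by move=> /cE ->; rewrite ps_poly hornerC mulr1.
rewrite -(lE z az); apply: (ctends_near _ (ps_continuous (cK _ _ cB) zr)).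
by apply: filterS (disc_near az) => w /lE.
Qed.

Lemma iwc_lam_phi : exists c B, [/\ l2_le a c B &
  forall z, disc a z -> ps c z = lam z * phi z].
Proof.
have [B /(iwc_fwd h)[c cB cE]] := l2_le_poly 'X b0.
by exists c, (M * B); split => // z /cE ->; rewrite ps_poly hornerX.
Qed.

Lemma iwc_lam : exists c B, [/\ l2_le a c B &
  forall z, disc a z -> ps c z = lam z].
Proof.
have [B /(iwc_fwd h)[c cB cE]] := l2_le_poly 1 b0.
by exists c, (M * B); split => // z /cE ->; rewrite ps_poly hornerC mulr1.
Qed.

Lemma iwc_derivable z : disc a z -> exists d, cderiv phi z d.
Proof.
move=> az; have [cu [Bu [cuB uE]]] := iwc_lam_phi.
have [cv [Bv [cvB vE]]] := iwc_lam.
have [r [zr rD [K cK]]] := disc_pbound a0 az.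
have r0 := le_lt_trans (cm_ge0 z) zr.
have duK := pboundB (phi z) (ltW r0) (cK _ _ cuB) (cK _ _ cvB).
have [g gK gE] := ps_ddiff duK zr.
exists (ps g z / lam z), (fun w => ps g w / lam w).
  apply: ctendsM; first exact: ps_continuous gK zr.
  by apply: ctendsV; [exact: iwc_lam_neq0|exact: iwc_lam_continuous].
apply: filterS (near_cm_lt zr) => w wr; have aw := rD _ wr.
have := gE w wr; rewrite !(psB _ (cK _ _ cuB) (cK _ _ cvB)) //.
rewrite !uE // !vE // [lam z * _]mulrC subrr add0r => E.
have l0 := iwc_lam_neq0 aw.
by rewrite mulrA -E; field.
Qed.

(** Substituting $\varphi(w)$ turns the increment from $\varphi(z)$ into $w-z$
    times a difference quotient tending to $d$. *)
Lemma iwc_lead n c G l c' z d : disc a z -> cderiv phi z d ->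
  (forall w, disc a w -> ps c' w = lam w * ps c (phi w)) ->
  (\forall w \near cnbhs (phi z), ps c w = (w - phi z) ^+ n * G w) ->
  ctends (cnbhs (phi z)) G l ->
  exists2 H, ctends (cnbhs z) H (lam z * d ^+ n * l) &
    \forall w \near cnbhs z, ps c' w = (w - z) ^+ n * H w.
Proof.
move=> az dphi c'E cG Gl.
have phic := cderiv_continuous dphi; have [X Xd phiX] := dphi.
exists (fun w => lam w * X w ^+ n * G (phi w)).
  apply: ctendsM; last exact: (ctends_compose phic Gl).
  by apply: ctendsM; [exact: iwc_lam_continuous|exact: ctendsX].
apply: filterS2 (ctends_comp phic cG) (filterI phiX (disc_near az)) => w {}cG [{}phiX aw].
by rewrite c'E // cG {1}phiX addrC addKr exprMn; ring.
Qed.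

(** The function carried to $w-z$ vanishes at $\varphi(z)$, so the simple zero
    of $w-z$ can only come from a simple zero of $\varphi(w)-\varphi(z)$. *)
Lemma iwc_deriv_neq0 z d : disc a z -> cderiv phi z d -> d != 0.
Proof.
move=> az dphi; have [B /(iwc_bwd h)[c cB cE]] := l2_le_poly ('X - z%:P) a0.
have bz := iwc_disc h az.
have [r [zr rD [K cK]]] := disc_pbound b0 bz.
have [g gK gE] := ps_ddiff (cK _ _ cB) zr.
have c0 : ps c (phi z) = 0.
  have := cE z az; rewrite ps_poly hornerXsubC subrr => /esym/eqP.
  by rewrite mulf_eq0 (negbTE (iwc_lam_neq0 az)) => /eqP.
have [|H Hl HE] := @iwc_lead 1 c (ps g) _ _ z d az dphi cE _ (ps_continuous gK zr).
  by apply: filterS (near_cm_lt zr) => w wr; rewrite gE // c0 add0r expr1.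
have E : lam z * d ^+ 1 * ps g (phi z) = 1.
  apply: (ctends_punctured_unique _ Hl (ctends_cst 1)).
  apply: filterS HE => w; rewrite ps_poly hornerXsubC expr1 => E wz.
  have wz0 : w - z != 0 by rewrite subr_eq0.
  by apply: (mulfI wz0); rewrite -E mulr1.
by apply/eqP => d0; move/eqP: E; rewrite d0 expr1 mulr0 mul0r eq_sym oner_eq0.
Qed.

Lemma iwc_continuous z : disc a z -> ctends (cnbhs z) phi (phi z).
Proof. by move=> /iwc_derivable[d]; apply: cderiv_continuous. Qed.

End Local.
End WeightedCompositions.

(** * Compactness and connectedness in the plane *)

Section PlaneTopology.
Variable R : realType.
Implicit Types (z w e : R[i]) (x t B : R).

Lemma cm_le_ReIm z : cm z <= `|Re z| + `|Im z|.
Proof.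
rewrite -(@ler_pXn2r _ 2) ?nnegrE ?addr_ge0 // cmsqr sqrrD !real_normK ?num_real //.
by rewrite -addrA lerD2l lerDr mulrn_wge0 // mulr_ge0.
Qed.

Lemma cluster_pair (u v : nat -> R[i]) B :
  (forall n, cm (u n) <= B) -> (forall n, cm (v n) <= B) ->
  exists l m, forall e : R, 0 < e -> forall N, exists2 n, (N <= n)%N &
    cm (u n - l) < e /\ cm (v n - m) < e.
Proof.
move=> uB vB.
pose s n : 'rV[R]_4 :=
  \row_(i < 4) [:: Re (u n); Im (u n); Re (v n); Im (v n)]`_i.
have cK : compact [set r : 'rV[R]_4 | forall i, `[- B, B]%classic (r ord0 i)].
  by apply: (@rV_compact _ _ (fun=> `[- B, B]%classic)) => _; exact: segment_compact.
have sK : (s @ \oo) [set r : 'rV[R]_4 | forall i, `[- B, B]%classic (r ord0 i)].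
  exists 0%N => // n _ /= i; rewrite mxE in_itv /= -ler_norml.
  case: i => -[|[|[|[|//]]]] /= _.
  - exact: le_trans (Re_le_cm _) (uB n).
  - exact: le_trans (Im_le_cm _) (uB n).
  - exact: le_trans (Re_le_cm _) (vB n).
  - exact: le_trans (Im_le_cm _) (vB n).
have [r [_ sr]] := cK (s @ \oo) _ sK.
exists (Complex (r ord0 0) (r ord0 1)), (Complex (r ord0 2%:R) (r ord0 3%:R)).
move=> e e0 N; have e2 : 0 < e / 2 by rewrite divr_gt0.
have [||y [[n /= Nn <-]]] := sr [set s n | n in [set n | (N <= n)%N]] (ball r (e / 2)).
- by exists N => // n /= Nn; exists n.
- exact: nbhsx_ballx.
rewrite /ball /= /mx_ball => -[_ h]; exists n => //.
have {}h i : `|r ord0 i - s n ord0 i| < e / 2 by apply: h.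
have := (h 0, h 1, h 2%:R, h 3%:R); rewrite !mxE /= => -[[[h0 h1] h2] h3].
split; apply: (le_lt_trans (cm_le_ReIm _));
  rewrite ReD ImD ReN ImN /= [X in X + _]distrC [X in _ + X]distrC; lra.
Qed.

(** Weierstrass's theorem in terms of sequences: closedness and upper
    semicontinuity are phrased by nearby pairs of the set, which is how the
    pointwise continuity of symbols enters. *)
Lemma max_attained (P : R[i] -> R[i] -> Prop) (F : R[i] -> R[i] -> R) B :
  (exists z w, P z w) ->
  (forall z w, P z w -> cm z <= B /\ cm w <= B) ->
  (forall z w, (forall e : R, 0 < e -> exists z' w',
     [/\ P z' w', cm (z' - z) < e & cm (w' - w) < e]) -> P z w) ->
  (forall z w, P z w -> forall e : R, 0 < e -> exists2 d : R, 0 < d &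
     forall z' w', P z' w' -> cm (z' - z) < d -> cm (w' - w) < d ->
     F z' w' < F z w + e) ->
  exists z w, P z w /\ forall z' w', P z' w' -> F z' w' <= F z w.
Proof.
move=> P0 Pb Pc Fc.
have cl (u v : nat -> R[i]) : (forall n, P (u n) (v n)) ->
    exists l m, P l m /\ forall e : R, 0 < e -> forall N, exists2 n, (N <= n)%N &
      F (u n) (v n) < F l m + e.
  move=> uv; have [l [m lm]] :=
    cluster_pair (fun n => (Pb _ _ (uv n)).1) (fun n => (Pb _ _ (uv n)).2).
  have Plm : P l m.
    by apply: Pc => e e0; have [n _ []] := lm e e0 0%N; exists (u n), (v n).
  exists l, m; split => // e e0 N; have [d d0 dP] := Fc _ _ Plm e e0.
  by have [n Nn [h1 h2]] := lm d d0 N; exists n => //; apply: dP.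
pose S := [set y | exists z w, P z w /\ y = F z w].
have S0 : S !=set0 by have [z [w zw]] := P0; exists (F z w), z, w.
have Sb : has_ubound S.
  apply: contrapT => nb.
  have /choice[uv uvP] n : exists p : R[i] * R[i], P p.1 p.2 /\ n%:R <= F p.1 p.2.
    apply: contrapT => h; apply: nb; exists n%:R => _ [z [w [zw ->]]].
    by rewrite leNgt; apply/negP => /ltW hz; apply: h; exists (z, w).
  have [l [m [_ lm]]] := cl (fst \o uv) (snd \o uv) (fun n => (uvP n).1).
  have [n nN] := lm 1 ltr01 (Num.truncn `|F l m + 1|).+1.
  have := (uvP n).2 => /= h1 h2.
  have h3 : `|F l m + 1| < n%:R.
    by apply: lt_le_trans (truncnS_gt _) _; rewrite ler_nat.
  by have := ler_norm (F l m + 1); lra.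
have /choice[uv uvP] n : exists p : R[i] * R[i],
    P p.1 p.2 /\ sup S - n.+1%:R^-1 < F p.1 p.2.
  have [|_ [z [w [zw ->]]] h] := @sup_adherent _ S n.+1%:R^-1 _ (conj S0 Sb).
    by rewrite invr_gt0.
  by exists (z, w).
have [l [m [lmP lm]]] := cl (fst \o uv) (snd \o uv) (fun n => (uvP n).1).
exists l, m; split => // z w zw.
suff le_eps (e : R) : 0 < e -> F z w <= F l m + e by apply/ler_addgt0Pr.
move=> e0.
have e2 : 0 < e / 2 by rewrite divr_gt0.
have [n nN /=] := lm _ e2 (Num.truncn (e / 2)^-1).
have := (uvP n).2 => /= h1 h2.
have h3 : n.+1%:R^-1 < e / 2.
  rewrite invf_plt ?posrE //; apply: lt_le_trans (truncnS_gt _) _.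
  by rewrite ler_nat ltnS.
have h4 : F z w <= sup S by apply: ub_le_sup => //; exists z, w.
by move: h1 h2 h3 h4; move: (n.+1%:R^-1) (sup S) => k1 k2; lra.
Qed.

Definition cis x : R[i] := Complex (cos x) (sin x).

Lemma cm_cis x : cm (cis x) = 1.
Proof. by rewrite cmE /= cos2Dsin2 sqrtr1. Qed.

Lemma cisX x n : cis x ^+ n = cis (x *+ n).
Proof.
elim: n => [|n IH]; first by rewrite mulr0n /cis cos0 sin0.
rewrite exprS IH mulrS; apply: eq_ReIm; rewrite ?ReM ?ImM /= ?cosD ?sinD //; ring.
Qed.

Lemma cis_surj e : cm e = 1 -> exists x, e = cis x.
Proof.
move=> e1; have h : Re e ^+ 2 + Im e ^+ 2 = 1 by rewrite -cmsqr e1 expr1n.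
have r1 : -1 <= Re e <= 1.
  by have := Re_le_cm e; rewrite e1 ler_norml.
have cE : cos (acos (Re e)) = Re e by apply: acosK; rewrite in_itv.
have sE : sin (acos (Re e)) = `|Im e|.
  by rewrite sin_acos // -sqrtr_sqr; congr Num.sqrt; lra.
have [i0|i0] := leP 0 (Im e).
  by exists (acos (Re e)); apply: eq_ReIm; rewrite /= ?cE // sE ger0_norm.
exists (- acos (Re e)); apply: eq_ReIm; rewrite /= ?cosN ?cE // sinN sE.
by rewrite ltr0_norm // opprK.
Qed.

Lemma cis_continuous x : ctends (nbhs x) cis (cis x).
Proof. by split; [exact: continuous_cos|exact: continuous_sin]. Qed.

Lemma path_IVT (gam : R -> R[i]) (F : R[i] -> R[i]) (s t v : R) :
  s <= t ->
  (forall x, s <= x <= t -> ctends (nbhs x) gam (gam x) /\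
     ctends (cnbhs (gam x)) F (F (gam x))) ->
  Num.min (cm (F (gam s))) (cm (F (gam t))) <= v <=
    Num.max (cm (F (gam s))) (cm (F (gam t))) ->
  exists2 x, s <= x <= t & cm (F (gam x)) = v.
Proof.
move=> st gF hv.
have cf : {within `[s, t], continuous (fun x => cm (F (gam x)))}.
  apply: continuous_in_subspaceT => x /set_mem /=; rewrite in_itv /= => xst.
  have [g1 F1] := gF x xst.
  exact: ctends_cm (ctends_compose g1 F1).
have [x xst <-] := IVT st cf hv.
by exists x => //; move: xst; rewrite in_itv.
Qed.

Lemma circle_IVT (F : R[i] -> R[i]) e1 e2 v :
  cm e1 = 1 -> cm e2 = 1 ->
  (forall e, cm e = 1 -> ctends (cnbhs e) F (F e)) ->
  cm (F e1) <= v <= cm (F e2) -> exists2 e, cm e = 1 & cm (F e) = v.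
Proof.
move=> /cis_surj[x1 ->] /cis_surj[x2 ->] Fc hv.
have cc x : ctends (nbhs x) cis (cis x) /\ ctends (cnbhs (cis x)) F (F (cis x)).
  by split; [exact: cis_continuous|apply/Fc/cm_cis].
have [le|/ltW le] := leP x1 x2.
- have [||x _ xv] := @path_IVT cis F x1 x2 v le; first by move=> x _; exact: cc.
    by rewrite ge_min le_max; case/andP: hv => -> ->; rewrite orbT.
  by exists (cis x); rewrite ?cm_cis.
- have [||x _ xv] := @path_IVT cis F x2 x1 v le; first by move=> x _; exact: cc.
    by rewrite ge_min le_max; case/andP: hv => -> ->; rewrite orbT.
  by exists (cis x); rewrite ?cm_cis.
Qed.

Lemma segment_IVT (F : R[i] -> R[i]) z v :
  (forall t, 0 <= t <= 1 -> ctends (cnbhs (t%:C * z)) F (F (t%:C * z))) ->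
  cm (F z) <= v <= cm (F 0) -> exists2 t, 0 <= t <= 1 & cm (F (t%:C * z)) = v.
Proof.
move=> Fc hv.
have gc x : ctends (nbhs x) (fun t => t%:C * z) (x%:C * z).
  apply: ctendsM; last exact: ctends_cst.
  by split => /=; [exact: cvg_id|exact: cvg_cst].
apply: (@path_IVT (fun t => t%:C * z) F 0 1 v) => //.
  by move=> x x01; split; [exact: gc|exact: Fc].
rewrite mul0r mul1r ge_min le_max; case/andP: hv => -> ->.
by rewrite orbT.
Qed.

(** With $\omega=e^{2\pi i/(3k)}$, which has positive real part for $k\ge2$, the
    $k$-th powers of $1,\omega,\bar\omega$ are the cube roots of unity, which
    no open half plane through the origin misses. *)
Lemma sector_power k (y : R[i]) : (1 < k)%N -> y != 0 ->
  exists2 e, 0 < Re e & Re (e ^+ k * y) < 0.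
Proof.
move=> k1 y0; pose th : R := pi * (2 / 3).
have pi0 := pi_gt0 R.
have k0 : 0 < k%:R :> R by rewrite ltr0n ltnW.
have k2 : 2 <= k%:R :> R by rewrite ler_nat.
pose x := th / k%:R.
have xk : x *+ k = th by rewrite -mulr_natr /x divfK // gt_eqF.
have cth : cos th < 0.
  rewrite -(opprK th) -[- - th](addrNK pi) cosDpi oppr_lt0.
  by apply: cos_gt0_pihalf; rewrite /th; lra.
have sth : 0 < sin th by apply: sin_gt0_pi; rewrite /th; lra.
have x0 : 0 < x by rewrite divr_gt0 // /th; lra.
have xp : x < pi / 2.
  by rewrite /x ltr_pdivrMr //; rewrite /th; nra.
have cx : 0 < cos x by apply: cos_gt0_pihalf; lra.
have cE s : Re (cis s ^+ k * y) = cos (s *+ k) * Re y - sin (s *+ k) * Im y.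
  by rewrite cisX ReM.
have [yl|yg|ye] := ltgtP (Re y) 0.
- by exists 1; rewrite ?expr1n ?mul1r.
- have [il|ig] := leP (Im y) 0; last first.
    by exists (cis x) => //; rewrite cE xk; nra.
  exists (cis (- x)); first by rewrite /= cosN.
  by rewrite cE mulNrn xk cosN sinN; nra.
- have [il|ig|ie] := ltgtP (Im y) 0.
  + exists (cis (- x)); first by rewrite /= cosN.
    by rewrite cE mulNrn xk cosN sinN ye; nra.
  + by exists (cis x) => //; rewrite cE xk ye; nra.
  + by move/eqP: y0; case; apply: eq_ReIm.
Qed.

End PlaneTopology.

(** * Leading coefficients and fixed points *)

Section Comparison.
Variable R : realType.
Implicit Types (a b y : nat -> R) (c : nat -> R[i]) (lam phi : R[i] -> R[i]).
Implicit Types (z w q s e : R[i]) (r K M B : R).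

(** Any local expansion of order $n$ already is a factorization on the whole
    disc, with the bound on the cofactor that makes the $n$-th leading
    coefficient a bounded functional. *)
Lemma ps_factor c r K q n G l : pbound c r K -> cm q < r ->
  (\forall z \near cnbhs q, z != q -> ps c z = (z - q) ^+ n * G z) ->
  ctends (cnbhs q) G l ->
  exists g, [/\ pbound g r (K / (r - cm q) ^+ n), ps g q = l &
    forall z, cm z < r -> ps c z = (z - q) ^+ n * ps g z].
Proof.
move=> cK qr cG Gl.
have [[k [g [K' [kn gK gq gE]]]]|[g gK gE]] := ps_order n cK qr.
  exfalso; move/eqP: gq; apply.
  have h : ctends (cnbhs q) (fun z => (z - q) ^+ (n - k) * G z)
      ((q - q) ^+ (n - k) * l).
    apply: ctendsM Gl; apply: ctendsX.
    exact: ctendsB (ctends_id q) (ctends_cst q).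
  rewrite subrr expr0n subn_eq0 leqNgt kn mul0r in h.
  apply: (ctends_punctured_unique (F := ps g) _ (ps_continuous gK qr) h).
  apply: filterS2 cG (near_cm_lt qr) => z + zr zq => /(_ zq); rewrite gE // => E.
  have d0 : (z - q) ^+ k != 0 by rewrite expf_neq0 // subr_eq0.
  by apply: (mulfI d0); rewrite E mulrA -exprD subnKC // ltnW.
exists g; split => //.
apply: (ctends_punctured_unique (F := ps g) _ (ps_continuous gK qr) Gl).
apply: filterS2 cG (near_cm_lt qr) => z + zr zq => /(_ zq); rewrite gE // => E.
have d0 : (z - q) ^+ n != 0 by rewrite expf_neq0 // subr_eq0.
exact: (mulfI d0).
Qed.

(** Orders of vanishing at the two origins are both read at their common image.
    The leading coefficients of the two images of one function, the first of
    which is chosen to be $z^n$, therefore compare the weights. *)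
Lemma iwc_compare a b y l1 f1 M1 l2 f2 M2 d1 d2 :
  (forall n, 0 < a n) -> (forall n, 0 < b n) -> (forall n, 0 < y n) ->
  disc a 0 -> disc b 0 ->
  iwc a y l1 f1 M1 -> iwc b y l2 f2 M2 -> f1 0 = f2 0 ->
  cderiv f1 0 d1 -> cderiv f2 0 d2 ->
  exists2 A : R, 0 < A & forall n, ((cm d2 / cm d1) ^+ 2) ^+ n * a n <= A * b n.
Proof.
move=> a0 b0 y0 Da Db h1 h2 f12 df1 df2.
have l10 := iwc_lam_neq0 a0 h1 Da; have l20 := iwc_lam_neq0 b0 h2 Db.
have d10 := iwc_deriv_neq0 a0 y0 h1 Da df1.
have L1 : 0 < cm (l1 0) by rewrite cm_gt0.
have L2 : 0 < cm (l2 0) by rewrite cm_gt0.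
have D1 : 0 < cm d1 by rewrite cm_gt0.
pose A0 := (M2 * M1 * (cm (l1 0) / cm (l2 0))) ^+ 2.
have A00 : 0 <= A0 by rewrite sqr_ge0.
exists (A0 + 1); first by rewrite ltr_wpDl.
move=> n; set s := Num.sqrt (a n)^-1.
have [g gB gE] := iwc_bwd h1 (l2_le_monomial n a0).
have Dy := iwc_disc h1 Da.
have [r [qr _ [K gK]]] := disc_pbound y0 Dy.
have {}gK := gK _ _ gB.
have [[k [g1 [K1 [kn g1K g1q g1E]]]]|[g1 g1K g1E]] := ps_order n gK qr.
  (* a smaller order at the common image would be seen in z^n *)
  exfalso.
  have [|H Hl HE] := @iwc_lead _ a y a0 y0 _ _ _ h1 k g (ps g1) _ _ 0 d1 Da df1 gE
     _ (ps_continuous g1K qr).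
    by apply: filterS (near_cm_lt qr) => w; exact: g1E.
  have : l1 0 * d1 ^+ k * ps g1 (f1 0) != 0 by rewrite !mulf_neq0 ?expf_neq0.
  apply/negP; rewrite negbK; apply/eqP.
  have h0 : ctends (cnbhs 0) (fun z : R[i] => z ^+ (n - k)) (0 ^+ (n - k)).
    exact/ctendsX/ctends_id.
  rewrite expr0n subn_eq0 leqNgt kn in h0.
  apply: (ctends_punctured_unique _ Hl h0).
  apply: filterS HE => z; rewrite ps_poly hornerXn subr0 => E z0.
  apply: (mulfI (expf_neq0 k z0)); rewrite -E -exprD subnKC //; exact: ltnW.
have [|H Hl HE] := @iwc_lead _ a y a0 y0 _ _ _ h1 n g (ps g1) _ _ 0 d1 Da df1 gE
     _ (ps_continuous g1K qr).
  by apply: filterS (near_cm_lt qr) => w; exact: g1E.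
have E1 : l1 0 * d1 ^+ n * ps g1 (f1 0) = 1.
  apply: (ctends_punctured_unique _ Hl (ctends_cst 1)).
  apply: filterS HE => z; rewrite ps_poly hornerXn subr0 => E z0.
  by apply: (mulfI (expf_neq0 n z0)); rewrite -E mulr1.
have [c cB cE] := iwc_fwd h2 gB.
rewrite f12 in qr g1E E1.
have [|H2 Hl2 HE2] := @iwc_lead _ b y b0 y0 _ _ _ h2 n g (ps g1) _ _ 0 d2 Db df2 cE
     _ (ps_continuous g1K qr).
  by apply: filterS (near_cm_lt qr) => w; exact: g1E.
have [r' [r'0 _ [K' cK']]] := disc_pbound b0 Db; rewrite cm0 in r'0.
have cn : c n = l2 0 * d2 ^+ n * ps g1 (f2 0).
  apply: (ps_lead_coef r'0 (cK' _ _ cB) _ Hl2).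
  by apply: filterS HE2 => z; rewrite subr0.
have := l2_le_coef n b0 cB.
have -> : cm (c n) = cm (l2 0) / cm (l1 0) * (cm d2 / cm d1) ^+ n.
  have -> : c n = l2 0 / l1 0 * (d2 / d1) ^+ n.
    rewrite cn -[RHS]mulr1 -E1 expr_div_n; field.
    by rewrite l10 expf_neq0.
  by rewrite cmM cmX !cmM !cmV.
move=> h.
have sq : s ^+ 2 = (a n)^-1 by rewrite sqr_sqrtr // invr_ge0 ltW.
have {}h : (cm (l2 0) / cm (l1 0)) ^+ 2 * ((cm d2 / cm d1) ^+ 2) ^+ n * a n <=
    (M2 * M1) ^+ 2 * b n.
  rewrite -ler_pdivlMr //; move: h.
  have -> : (M2 * (M1 * s)) ^+ 2 * b n = (M2 * M1) ^+ 2 * b n / a n.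
    by rewrite -sq; ring.
  by rewrite exprMn [(_ ^+ n) ^+ 2]exprAC.
have -> : ((cm d2 / cm d1) ^+ 2) ^+ n * a n = (cm (l1 0) / cm (l2 0)) ^+ 2 *
    ((cm (l2 0) / cm (l1 0)) ^+ 2 * ((cm d2 / cm d1) ^+ 2) ^+ n * a n).
  by move: (_ ^+ n) => t; field; rewrite !gt_eqF.
apply: (@le_trans _ _ (A0 * b n)); last by rewrite ler_pM2r // lerDl.
have -> : A0 * b n = (cm (l1 0) / cm (l2 0)) ^+ 2 * ((M2 * M1) ^+ 2 * b n).
  by rewrite /A0; ring.
by rewrite ler_wpM2l ?sqr_ge0.
Qed.

Lemma pow_growth (x m C : R) : 0 <= x -> 0 <= m ->
  (forall j, x ^+ j <= C * m ^+ j) -> x <= m.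
Proof.
move=> x0 m0 h; rewrite leNgt; apply/negP => mx.
have xp : 0 < x by apply: le_lt_trans mx.
have k1 : `|m / x| < 1 by rewrite ger0_norm ?divr_ge0 // ltr_pdivrMr // mul1r.
have : C * (m / x) ^+ N @[N --> \oo] --> 0.
  rewrite -[X in _ --> X](mulr0 C).
  by apply: cvgM; [exact: cvg_cst|exact: cvg_expr].
move/cvgr_lt => /(_ 1 ltr01) [N _ /(_ N (leqnn N))] /=.
rewrite expr_div_n mulrA ltr_pdivrMr ?exprn_gt0 // mul1r.
by rewrite ltNge h.
Qed.

(** At a fixed point $s$ the operator multiplies the $n$-th leading coefficient
    by $\lambda(s)\varphi'(s)^n$; this functional being bounded, no such factor
    exceeds the norm of the operator. *)
Lemma iwc_fixed_deriv a lam phi M s d : (forall n, 0 < a n) ->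
  iwc a a lam phi M -> disc a s -> phi s = s -> cderiv phi s d -> cm d <= 1.
Proof.
move=> a0 h Ds fs df; have l0 := iwc_lam_neq0 a0 h Ds.
have L0 : 0 < cm (lam s) by rewrite cm_gt0.
have [r [sr rD [K cK]]] := disc_pbound a0 Ds.
have rs : 0 < r - cm s by rewrite subr_gt0.
apply: (@pow_growth _ _ (M / cm (lam s))) => // n; rewrite expr1n mulr1.
rewrite ler_pdivlMr // mulrC.
have [B0 pB] := l2_le_poly (('X - s%:P) ^+ n) a0.
pose C := B0 * K / (r - cm s) ^+ n * r / (r - cm s).
(* iterates of the operator on $(z-s)^n$ and their leading coefficients *)
have it j : exists c g K', [/\ l2_le a c (M ^+ j * B0), pbound g r K',
    ps g s = (lam s * d ^+ n) ^+ j &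
    forall z, cm z < r -> ps c z = (z - s) ^+ n * ps g z].
  elim: j => [|j [c [g [K' [cB gK gs gE]]]]].
    have g1 : \forall z \near cnbhs s, z != s ->
        ps (fun k => (('X - s%:P) ^+ n)`_k) z = (z - s) ^+ n * 1.
      by apply: nearW => z _; rewrite ps_poly horner_exp hornerXsubC mulr1.
    have [g [gK gs gE]] := ps_factor (cK _ _ pB) sr g1 (ctends_cst 1).
    exists (fun k => (('X - s%:P) ^+ n)`_k), g, (B0 * K / (r - cm s) ^+ n).
    by split => //; rewrite expr0 mul1r.
  have [c' cB' cE'] := iwc_fwd h cB.
  rewrite mulrA -exprS in cB'.
  have [||H Hl HE] := @iwc_lead _ a a a0 a0 _ _ _ h n c (ps g) (ps g s) _ s d Ds df cE'.
  - by rewrite fs; apply: filterS (near_cm_lt sr) => w; exact: gE.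
  - by rewrite fs; exact: ps_continuous gK sr.
  have [|g' [gK' gs' gE']] := ps_factor (n := n) (cK _ _ cB') sr _ Hl.
    by apply: filterS HE => z.
  exists c', g', (M ^+ j.+1 * B0 * K / (r - cm s) ^+ n).
  by split => //; rewrite gs' gs exprS.
apply: (@pow_growth _ _ C); rewrite ?(iwc_ge0 h) ?mulr_ge0 ?exprn_ge0 // => j.
have [c [g [K' [cB gK gs gE]]]] := it j.
have [|g' [gK' gs' _]] := ps_factor (n := n) (cK _ _ cB) sr _ (ps_continuous gK sr).
  by apply: filterS (near_cm_lt sr) => z zr _; exact: gE.
have := ps_le gK' sr; rewrite gs' gs cmX cmM cmX => /le_trans; apply.
by rewrite /C le_eqVlt; apply/orP; left; apply/eqP; ring.
Qed.

Lemma small_pos (A B x y : R) : 0 <= A -> 0 <= B -> 0 < x -> 0 < y ->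
  exists t : R, [/\ 0 < t, t <= 1, t * A < x & t * B < y].
Proof.
move=> A0 B0 x0 y0.
have a0 : 0 < x / (A + 1) by rewrite divr_gt0 // ltr_wpDl.
have b0 : 0 < y / (B + 1) by rewrite divr_gt0 // ltr_wpDl.
have le (t u v : R) : 0 < t -> 0 <= u -> t <= v / (u + 1) -> t * u < v.
  move=> t0 u0; rewrite ler_pdivlMr ?ltr_wpDl // => h.
  by apply: lt_le_trans h; rewrite ltr_pM2l // ltrDl.
exists (Num.min 1 (Num.min (x / (A + 1)) (y / (B + 1)))).
have t0 : 0 < Num.min 1 (Num.min (x / (A + 1)) (y / (B + 1))).
  by rewrite !lt_min ltr01 a0.
split => //; first by rewrite ge_min lexx.
- by apply: le => //; rewrite !ge_min lexx !orbT.
- by apply: le => //; rewrite !ge_min lexx !orbT.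
Qed.

Section LocalGrowth.
Variables (F Y : R[i] -> R[i]) (s y e : R[i]) (k : nat) (P : set R[i]).
Hypotheses (k0 : (0 < k)%N) (F0 : F s != 0) (Yy : ctends (cnbhs s) Y y).
Hypothesis FY : \forall z \near cnbhs s, F z = F s * (1 + (z - s) ^+ k * Y z).
Hypothesis nP : \forall z \near cnbhs s, P z.

Let cmF (u : R) : F (s + u%:C * e) =
    F s * (1 + (s + u%:C * e - s) ^+ k * Y (s + u%:C * e)) ->
  cm (F (s + u%:C * e)) =
    cm (F s) * cm (1 + (u ^+ k)%:C * (e ^+ k * Y (s + u%:C * e))).
Proof.
by move=> ->; rewrite cmM [s + _]addrC addrK exprMn rmorphXn /= mulrA.
Qed.

Let Wy : ctends (cnbhs s) (fun z => e ^+ k * Y z) (e ^+ k * y).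
Proof. exact: ctendsM (ctends_cst _) Yy. Qed.

(** A leading term pointing against (along) the value makes the modulus
    decrease (increase) in the corresponding direction. *)
Lemma modulus_decrease : Re (e ^+ k * y) < 0 ->
  exists t : R, [/\ 0 < t, P (s + t%:C * e) & cm (F (s + t%:C * e)) < cm (F s)].
Proof.
set W := e ^+ k * y => Wneg; pose n := - Re W / 2.
have n0 : 0 < n by rewrite /n divr_gt0 // oppr_gt0.
have /ctends_eps /(_ n n0) near1 := Wy.
have [d d0 dP] := near_cmp (filterI FY (filterI nP near1)).
have [t [t0 t1 te tW]] := @small_pos (cm e) ((cm W + n) ^+ 2) d (2 * n)
   (cm_ge0 _) (sqr_ge0 _) d0 (mulr_gt0 (ltr0Sn _ 1) n0).
exists t; have [|/cmF E [Pz /= zW]] := dP (s + t%:C * e).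
  by rewrite addrC addKr cmM cm_real gtr0_norm.
split => //; rewrite E gtr_pMr ?cm_gt0 //.
set V := e ^+ k * Y _ in zW *.
clearbody V.
have ReV : Re V <= - n.
  have := Re_le_cm (V - W); rewrite ReD ReN ler_norml => /andP[_].
  by rewrite /n in zW *; lra.
have cmV : cm V <= cm W + n by have := cm_sub V W; lra.
have u0 : 0 < t ^+ k by rewrite exprn_gt0.
have ut : t ^+ k <= t.
  by case: k k0 => // j _; rewrite exprS ger_pMr // exprn_ile1 // ltW.
have V2 : Re V ^+ 2 + Im V ^+ 2 <= (cm W + n) ^+ 2.
  by rewrite -cmsqr ler_pXn2r ?nnegrE // addr_ge0 // ltW.
rewrite -(@ltr_pXn2r _ 2) ?nnegrE // expr1n cmsqr ReD ImD ReM ImM /=.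
move: (t ^+ k) u0 ut => u u0 ut.
have h : u * (Re V ^+ 2 + Im V ^+ 2) < 2 * n.
  apply: le_lt_trans tW; apply: ler_pM => //; first exact: ltW.
  by rewrite addr_ge0 ?sqr_ge0.
have h1 : u * (u * (Re V ^+ 2 + Im V ^+ 2)) < u * (2 * n) by rewrite ltr_pM2l.
have h2 : u * Re V <= u * - n by rewrite ler_pM2l.
have -> : (1 + (u * Re V - 0 * Im V)) ^+ 2 + (0 + (u * Im V + 0 * Re V)) ^+ 2 =
    1 + 2 * (u * Re V) + u * (u * (Re V ^+ 2 + Im V ^+ 2)) by ring.
by lra.
Qed.

Lemma modulus_increase : 0 < Re (e ^+ k * y) ->
  exists t : R, [/\ 0 < t, P (s + t%:C * e) & cm (F s) < cm (F (s + t%:C * e))].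
Proof.
set W := e ^+ k * y => Wpos.
have /ctends_eps /(_ _ Wpos) near1 := Wy.
have [d d0 dP] := near_cmp (filterI FY (filterI nP near1)).
have [t [t0 t1 te _]] := @small_pos (cm e) 0 d 1 (cm_ge0 _) (lexx _) d0 ltr01.
exists t; have [|/cmF E [Pz /= zW]] := dP (s + t%:C * e).
  by rewrite addrC addKr cmM cm_real gtr0_norm.
split => //; rewrite E ltr_pMr ?cm_gt0 //.
set V := e ^+ k * Y _ in zW *.
clearbody V.
have ReV : 0 < Re V.
  have := Re_le_cm (V - W); rewrite ReD ReN ler_norml => /andP[].
  by lra.
have u0 : 0 < t ^+ k by rewrite exprn_gt0.
apply: lt_le_trans (Re_le_cm _); apply: lt_le_trans (ler_norm _).
by rewrite ReD ReM /= mul0r subr0 ltrDl mulr_gt0.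
Qed.

End LocalGrowth.

Lemma cm_scale_gt s e (t : R) : s != 0 -> 0 < t -> 0 < Re e ->
  cm s < cm (s + t%:C * (s * e)).
Proof.
move=> s0 t0 e0; have -> : s + t%:C * (s * e) = s * (1 + t%:C * e) by ring.
rewrite cmM ltr_pMr ?cm_gt0 //.
apply: lt_le_trans (Re_le_cm _); apply: lt_le_trans (ler_norm _).
by rewrite ReD ReM /= mul0r subr0 ltrDl mulr_gt0.
Qed.

(** The leading term of $\varphi(z)/z-1$ at $s$ points inwards for some outward
    direction: for order at least $2$ by [sector_power], for order $1$ because
    $|\varphi'(s)|\le1$ and $\varphi'(s)\ne1$. *)
Lemma iwc_fixed_not_extremal a lam phi M s : (forall n, 0 < a n) ->
  iwc a a lam phi M -> disc a s -> s != 0 -> phi s = s ->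
  ~ (\forall z \near cnbhs s, cm s < cm z -> cm z < cm (phi z)).
Proof.
move=> a0 h Ds s0 fs ext.
have [cu [Bu [cuB uE]]] := iwc_lam_phi a0 h.
have [cv [Bv [cvB vE]]] := iwc_lam a0 h.
have [r [sr rD [K cK]]] := disc_pbound a0 Ds.
have r0 := le_lt_trans (cm_ge0 s) sr.
have svK := pbound_shift (ltW r0) (cK _ _ cvB).
have dK := pboundB 1 (ltW r0) (cK _ _ cuB) svK.
have dE z : cm z < r ->
    ps (fun n => cu n - 1 * pshift cv n) z = lam z * (phi z - z).
  move=> zr; have az := rD _ zr.
  rewrite (psB _ (cK _ _ cuB) svK zr) (ps_shift (cK _ _ cvB) zr) uE // vE //.
  by ring.
have [[k [g [K' [gK gs gE]]]]|flat] := ps_order_infinite dK sr; last first.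
  (* here phi is the identity near s and preserves moduli *)
  have rs : 0 < r - cm s by rewrite subr_gt0.
  have near1 : \forall z \near cnbhs s, phi z = z.
    apply: filterS2 (near_ball s rs) (near_cm_lt sr) => z zs zr.
    have := flat z zs; rewrite dE // => /eqP; rewrite mulf_eq0.
    by rewrite (negbTE (iwc_lam_neq0 a0 h (rD _ zr))) /= subr_eq0 => /eqP.
  have [d d0 dP] := near_cmp (filterI ext near1).
  have [t [t0 _ ts _]] := @small_pos (cm s) 0 d 1 (cm_ge0 _) (lexx _) d0 ltr01.
  have [|] := dP (s + t%:C * (s * 1)).
    by rewrite addrC addKr mulr1 cmM cm_real gtr0_norm.
  by move=> h1 h2; move: h1; rewrite h2 ltxx cm_scale_gt // => /(_ isT).
have L0 := iwc_lam_neq0 a0 h Ds.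
have Lc := iwc_lam_continuous a0 a0 h Ds.
have phiE z : cm z < r -> phi z = z + (z - s) ^+ k * (ps g z / lam z).
  move=> zr; have := gE z zr; rewrite dE // => E.
  have l0 := iwc_lam_neq0 a0 h (rD _ zr).
  by rewrite mulrA -E mulrAC mulfV // mul1r addrC subrK.
pose x := ps g s / lam s.
have x0 : x != 0 by rewrite mulf_neq0 ?invr_neq0.
have Xx : ctends (cnbhs s) (fun z => ps g z / lam z) x.
  by apply: ctendsM (ps_continuous gK sr) (ctendsV L0 Lc).
have k0 : (0 < k)%N.
  rewrite lt0n; apply/eqP => k0; have := phiE s sr.
  rewrite fs k0 expr0 mul1r -[LHS]addr0 => /addrI /esym/eqP.
  by rewrite (negbTE x0).
have [e e0 ek] : exists2 e, 0 < Re e & Re ((s * e) ^+ k * (x / s)) < 0.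
  have [k1|k1] := leqP k 1; last first.
    have [|e e0 ek] := @sector_power _ k (s ^+ k * (x / s)) k1.
      by rewrite !mulf_neq0 ?expf_neq0 ?invr_neq0.
    by exists e => //; rewrite exprMn [s ^+ k * _]mulrC -mulrA.
  have {}k1 : k = 1%N by apply/eqP; rewrite eqn_leq k1.
  exists 1; first exact: ltr01.
  rewrite k1 expr1 mulr1 mulrCA mulfV // mulr1.
  have df : cderiv phi s (1 + x).
    exists (fun z => 1 + ps g z / lam z); first exact: ctendsD (ctends_cst 1) Xx.
    by apply: filterS (near_cm_lt sr) => z /phiE ->; rewrite k1 fs; ring.
  have := iwc_fixed_deriv a0 h Ds fs df.
  have : 0 < cm x ^+ 2 by rewrite exprn_gt0 // cm_gt0.
  rewrite cmsqr => xx; rewrite -(@ler_pXn2r _ 2) ?nnegrE // expr1n cmsqr ReD ImD /=.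
  nra.
have Yc : ctends (cnbhs s) (fun z => ps g z / lam z / z) (x / s).
  exact: ctendsM Xx (ctendsV s0 (ctends_id s)).
have zn0 : \forall z \near cnbhs s, z != 0 by apply: ctends_neq0 s0 (ctends_id s).
have [|||t [t0 [tP1 tP2]]] := @modulus_decrease (fun z => phi z / z)
   (fun z => ps g z / lam z / z) s (x / s) (s * e) k
   (fun z => z != 0 /\ (cm s < cm z -> cm z < cm (phi z))) k0 _ Yc _ _ ek.
- by rewrite fs mulfV ?oner_neq0.
- apply: filterS2 zn0 (near_cm_lt sr) => z z0 zr.
  by rewrite phiE // fs mulfV //; field; rewrite z0 (iwc_lam_neq0 a0 h (rD _ zr)).
- exact: filterI zn0 ext.
rewrite fs mulfV // cm1 cmM cmV ltr_pdivrMr ?cm_gt0 // mul1r.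
by rewrite ltNge ltW // tP2 // cm_scale_gt.
Qed.

End Comparison.

(** * A common image of the origins *)

Section CommonPoint.
Variable R : realType.
Implicit Types (a b y : nat -> R) (lam phi f g : R[i] -> R[i]).
Implicit Types (z w p q s e : R[i]) (M : R).

Lemma same_cm_unit z w : cm z = cm w -> exists2 e, cm e = 1 & z = w * e.
Proof.
move=> zw; have [w0|w0] := eqVneq w 0.
  exists 1; first exact: cm1.
  by move: zw; rewrite w0 cm0 mul0r => /eqP; rewrite cm_eq0 => /eqP.
exists (z / w); last by rewrite mulrC divfK.
by rewrite cmM cmV zw mulfV // cm_eq0.
Qed.

Lemma cm_limit_le z (F : R[i] -> R[i]) (B : R) w :
  ctends (cnbhs z) F w ->
  (forall e : R, 0 < e -> exists2 z', cm (z' - z) < e & cm (F z') <= B + e) ->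
  cm w <= B.
Proof.
move=> Fw h.
suff le_eps (e : R) : 0 < e -> cm w <= B + e by apply/ler_addgt0Pr.
move=> e0; have e2 : 0 < e / 2 by rewrite divr_gt0.
have /ctends_eps /(_ _ e2) /near_cmp[d d0 dP] := Fw.
have m0 : 0 < Num.min d (e / 2) by rewrite lt_min d0.
have [z' zz' Fz'] := h _ m0.
have /dP h1 : cm (z' - z) < d by apply: lt_le_trans zz' _; rewrite ge_min lexx.
have h2 : cm (F z') <= B + e / 2.
  by apply: le_trans Fz' _; rewrite lerD2l ge_min lexx orbT.
by have := cm_sub w (F z'); rewrite cmBC; lra.
Qed.

Section OneMap.
Variables (a b : nat -> R) (a0 : forall n, 0 < a n) (b0 : forall n, 0 < b n).
Variables (lam phi : R[i] -> R[i]) (M : R) (h : iwc a b lam phi M).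

Lemma iwc_expansion z : disc a z -> phi z != 0 -> exists Y v, [/\ v != 0,
  ctends (cnbhs z) Y v &
  \forall w \near cnbhs z, phi w = phi z * (1 + (w - z) ^+ 1 * Y w)].
Proof.
move=> az f0; have [d df] := iwc_derivable a0 b0 h az.
have d0 := iwc_deriv_neq0 a0 b0 h az df; have [X Xd fX] := df.
exists (fun w => X w / phi z), (d / phi z); split.
- by rewrite mulf_neq0 ?invr_neq0.
- exact: ctendsM Xd (ctends_cst _).
- by apply: filterS fX => w ->; field.
Qed.

Lemma disc_max (F : R[i] -> R) p : disc a p ->
  (forall z, disc a z -> forall e : R, 0 < e ->
     \forall w \near cnbhs z, F w < F z + e) ->
  exists2 z, cm z <= cm p & forall w, cm w <= cm p -> F w <= F z.
Proof.
move=> ap Fc.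
have [||||z [w [[zp _] zmax]]] := @max_attained R
  (fun z w => cm z <= cm p /\ w = 0) (fun z _ => F z) (cm p).
- by exists p, 0; split.
- by move=> z w [zp ->]; rewrite cm0.
- move=> z w cl; split.
    apply: (cm_limit_le (ctends_id z)) => e e0.
    have [z' [w' [[z'p _] zz' _]]] := cl e e0; exists z' => //.
    by rewrite ler_wpDr // ltW.
  apply/eqP; rewrite -cm_eq0 eq_le cm_ge0 andbT leNgt; apply/negP => w0.
  by have [z' [w' [[_ ->] _]]] := cl _ w0; rewrite sub0r cmN ltxx.
- move=> z w [zp _] e e0; have [d d0 dP] := near_cmp (Fc z (disc_le zp ap) e e0).
  by exists d => // z' w' _ /dP.
by exists z => // v vp; apply: zmax (conj vp erefl).
Qed.

(** As $\varphi'$ has no zero, the modulus of $\varphi$ increases in some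
    direction at each interior point where $\varphi$ is not zero, and decreases
    in another. *)
Lemma iwc_max_modulus p : disc a p ->
  exists2 e, cm e = 1 & cm (phi 0) <= cm (phi (p * e)).
Proof.
move=> ap; have [z az e e0|z zp zmax] := @disc_max (fun z => cm (phi z)) p ap.
  have /ctends_eps /(_ e e0) := iwc_continuous a0 b0 h az.
  by apply: filterS => w; have := cm_sub (phi w) (phi z); lra.
have m0 : cm (phi 0) <= cm (phi z) by apply: zmax; rewrite cm0.
have [zE|zE] := eqVneq (cm z) (cm p).
  by have [e e1 ze] := same_cm_unit zE; exists e; rewrite -?ze.
have {zE}zp : cm z < cm p by rewrite lt_neqAle zE.
have [f0|f0] := eqVneq (phi z) 0.
  exists 1; first exact: cm1.
  by apply: (le_trans m0); rewrite f0 cm0.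
have az := disc_le (ltW zp) ap.
have [Y [y [y0 Yy fY]]] := iwc_expansion az f0.
have [|t [_ tp]] := @modulus_increase R phi Y z y y^-1 1 _ f0 Yy fY
  (near_cm_lt zp).
  by rewrite expr1 mulVf //; exact: ltr01.
by rewrite ltNge zmax // ltW.
Qed.

Lemma iwc_min_modulus p : disc a p ->
  (forall e, cm e = 1 -> cm (phi 0) < cm (phi (p * e))) ->
  exists2 s, cm s < cm p & phi s = 0.
Proof.
move=> ap big; have [z az e e0|z zp zmin] := @disc_max (fun z => - cm (phi z)) p ap.
  have /ctends_eps /(_ e e0) := iwc_continuous a0 b0 h az.
  by apply: filterS => w; rewrite cmBC; have := cm_sub (phi z) (phi w); lra.
have m0 : cm (phi z) <= cm (phi 0).
  by have := zmin 0; rewrite cm0 lerN2; apply.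
have {}zp : cm z < cm p.
  rewrite lt_neqAle zp andbT; apply/eqP => /same_cm_unit[e e1 ze].
  by have := big e e1; rewrite -ze ltNge m0.
exists z => //; apply/eqP; apply: contraT => f0.
have az := disc_le (ltW zp) ap.
have [Y [y [y0 Yy fY]]] := iwc_expansion az f0.
have [|t [_ tp]] := @modulus_decrease R phi Y z y (- y^-1) 1 _ isT f0 Yy fY
  (near_cm_lt zp).
  by rewrite expr1 mulNr mulVf // ReN oppr_lt0; exact: ltr01.
by rewrite ltNge -lerN2 zmin // ltW.
Qed.

End OneMap.

Definition comparable a b :=
  exists C c gamma : R, [/\ 0 < C, 0 < c, 0 < gamma &
    forall n : nat, c <= b n / a n * gamma ^+ n <= C].

Lemma comparable_sym a b : (forall n, 0 < a n) -> (forall n, 0 < b n) ->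
  comparable a b -> comparable b a.
Proof.
move=> a0 b0 [C [c [g [C0 c0 g0 h]]]]; exists c^-1, C^-1, g^-1.
split; rewrite ?invr_gt0 // => n.
have -> : a n / b n * g^-1 ^+ n = (b n / a n * g ^+ n)^-1.
  by rewrite exprVn !invfM invrK [_^-1 * a n]mulrC.
have /andP[h1 h2] := h n; have x0 := lt_le_trans c0 h1.
by rewrite !lef_pV2 ?posrE // h1 h2.
Qed.

(** Both inequalities come from [iwc_compare], applied twice with the roles of
    the two spaces exchanged; the rates obtained are inverse to each other. *)
Lemma comparable_common a b y l1 f1 M1 l2 f2 M2 :
  (forall n, 0 < a n) -> (forall n, 0 < b n) -> (forall n, 0 < y n) ->
  disc a 0 -> disc b 0 ->
  iwc a y l1 f1 M1 -> iwc b y l2 f2 M2 -> f1 0 = f2 0 -> comparable a b.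
Proof.
move=> a0 b0 y0 Da Db h1 h2 f12.
have [d1 df1] := iwc_derivable a0 y0 h1 Da.
have [d2 df2] := iwc_derivable b0 y0 h2 Db.
have D1 : 0 < cm d1 by rewrite cm_gt0 (iwc_deriv_neq0 a0 y0 h1 Da df1).
have D2 : 0 < cm d2 by rewrite cm_gt0 (iwc_deriv_neq0 b0 y0 h2 Db df2).
have [A A0 hA] := iwc_compare a0 b0 y0 Da Db h1 h2 f12 df1 df2.
have [B B0 hB] := iwc_compare b0 a0 y0 Db Da h2 h1 (esym f12) df2 df1.
exists B, A^-1, ((cm d1 / cm d2) ^+ 2); split; rewrite ?invr_gt0 //.
  by rewrite exprn_gt0 // divr_gt0.
move=> n; apply/andP; split; last first.
  by rewrite mulrC mulrA ler_pdivrMr.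
have g0 : 0 < ((cm d1 / cm d2) ^+ 2) ^+ n by rewrite !exprn_gt0 // divr_gt0.
have := hA n.
have -> : (cm d2 / cm d1) ^+ 2 = ((cm d1 / cm d2) ^+ 2)^-1.
  by rewrite -exprVn invf_div.
rewrite exprVn; move: (_ ^+ n) g0 => g g0 hn.
rewrite -[A^-1]mul1r ler_pdivrMr // -(ler_pM2r (a0 n)) mul1r.
rewrite -ler_pdivlMl ?invr_gt0 // in hn.
have -> : b n / a n * g * A * a n = (g^-1)^-1 * (A * b n).
  by rewrite invrK; field; rewrite gt_eqF.
exact: hn.
Qed.

Section TwoMaps.
Variables (a b : nat -> R) (a0 : forall n, 0 < a n) (b0 : forall n, 0 < b n).
Variables (Da : disc a 0) (Db : disc b 0).

(** If $|\psi(\eta p)|\le|q|$ for one $\eta$, the maximum principle provides the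
    reverse inequality for another one, and a rotated composite of the two
    symbols sends the origin to $q=\psi(0)$. *)
Lemma common_or_expanding lf f Mf lg g Mg :
  iwc a b lf f Mf -> iwc b a lg g Mg ->
  comparable a b \/ forall e, cm e = 1 -> cm (g 0) < cm (g (f 0 * e)).
Proof.
move=> hf hg; have bp := iwc_disc hf Da.
have [[e0 e01 le0]|none] := pselect (exists2 e, cm e = 1 & cm (g (f 0 * e)) <= cm (g 0)).
  left; have [e1 e11 le1] := iwc_max_modulus b0 a0 hg bp.
  have [||e e1' ge] := @circle_IVT R (fun e => g (f 0 * e)) e0 e1 (cm (g 0)) e01 e11.
  - move=> e e1'; apply: (ctends_compose (f := fun e => f 0 * e)).
      exact: ctendsM (ctends_cst _) (ctends_id e).
    apply: (iwc_continuous b0 a0 hg); apply: disc_le bp.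
    by rewrite cmM e1' mulr1.
  - by rewrite le0 le1.
  have [u u1 ug] := same_cm_unit (esym ge).
  have h1 := iwc_comp (iwc_comp (iwc_comp hf (iwc_rot b e1')) hg) (iwc_rot a u1).
  apply: (comparable_common a0 b0 a0 Da Db h1 hg) => /=.
  by rewrite [u * _]mulrC [e * _]mulrC -ug.
right=> e e1; rewrite ltNge; apply/negP => le.
by apply: none; exists e.
Qed.

(** If both maps expanded the circle through the image of the other origin,
    an outermost point of $\{|\psi(\eta\varphi(z))|\le|z|\}$ over all rotations
    $\eta$ would be a fixed point of a rotated composite and contradict
    [iwc_fixed_not_extremal]. *)
Lemma not_both_expanding lf f Mf lg g Mg :
  iwc a b lf f Mf -> iwc b a lg g Mg ->
  (forall e, cm e = 1 -> cm (g 0) < cm (g (f 0 * e))) ->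
  (forall e, cm e = 1 -> cm (f 0) < cm (f (g 0 * e))) -> False.
Proof.
move=> hf hg eg ef; set p := f 0 in eg ef *; set q := g 0 in eg ef *.
have bp : disc b p := iwc_disc hf Da; have aq : disc a q := iwc_disc hg Db.
have fc z : cm z <= cm q -> ctends (cnbhs z) f (f z).
  by move=> zq; apply: (iwc_continuous a0 b0 hf); apply: disc_le zq aq.
have gc w : cm w <= cm p -> ctends (cnbhs w) g (g w).
  by move=> wp; apply: (iwc_continuous b0 a0 hg); apply: disc_le wp bp.
have [s sp gs] := iwc_min_modulus b0 a0 hg bp eg.
have [s' s'q fs'] := iwc_min_modulus a0 b0 hf aq ef.
pose P z w := [/\ cm z <= cm q, cm w = cm (f z), cm w <= cm p & cm (g w) <= cm z].
have [||||z [w [[zq wf wp gw] zmax]]] := @max_attained R P (fun z _ => cm z) (cm q + cm p).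
- have ts z t : 0 <= t <= 1 -> cm (t%:C * s') <= cm s'.
    by move=> /andP[t0 t1]; rewrite cmM cm_real ger0_norm // ler_piMl.
  have [||t t01 tE] := @segment_IVT R f s' (cm s).
  + by move=> t /(ts 0) h; apply: fc; apply: le_trans h (ltW s'q).
  + by rewrite fs' cm0 cm_ge0 /= ltW.
  exists (t%:C * s'), s; split; rewrite ?gs ?cm0 //; last exact: ltW.
  exact: le_trans (ts 0 t t01) (ltW s'q).
- by move=> z w [zq _ wp _]; split; [rewrite ler_wpDr|rewrite ler_wpDl].
- move=> z w cl.
  have zq : cm z <= cm q.
    apply: (cm_limit_le (ctends_id z)) => e e0.
    have [z' [w' [[zq _ _ _] zz' _]]] := cl e e0.
    by exists z' => //; rewrite ler_wpDr // ltW.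
  have wp : cm w <= cm p.
    apply: (cm_limit_le (ctends_id w)) => e e0.
    have [z' [w' [[_ _ wp _] _ ww']]] := cl e e0.
    by exists w' => //; rewrite ler_wpDr // ltW.
  split => //.
    apply/eqP; rewrite eq_le; apply/andP; split.
      suff le_eps (e : R) : 0 < e -> cm w <= cm (f z) + e by apply/ler_addgt0Pr.
      move=> e0; have e2 : 0 < e / 2 by rewrite divr_gt0.
      have /ctends_eps /(_ _ e2) /near_cmp[d d0 dP] := fc z zq.
      have m0 : 0 < Num.min d (e / 2) by rewrite lt_min d0.
      have [z' [w' [[_ wf _ _]]]] := cl _ m0.
      rewrite !lt_min => /andP[/dP h1 _] /andP[_ h2].
      have := cm_sub (f z') (f z); have := cm_sub w w'.
      by rewrite [cm (w - w')]cmBC -wf; lra.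
    apply: (cm_limit_le (fc z zq)) => e e0.
    have [z' [w' [[_ wf _ _] zz' ww']]] := cl e e0.
    by exists z' => //; rewrite -wf; have := cm_sub w' w; lra.
  apply: (cm_limit_le (gc w wp)) => e e0.
  have [z' [w' [[_ _ _ gw] zz' ww']]] := cl e e0.
  by exists w' => //; apply: (le_trans gw); have := cm_sub z' z; lra.
- move=> z w _ e e0; exists e => // z' w' _ zz' _.
  by have := cm_sub z' z; lra.
have {}zq : cm z < cm q.
  rewrite lt_neqAle zq andbT; apply/eqP => /same_cm_unit[e e1 ze].
  by have := ef e e1; rewrite -ze -wf ltNge wp.
have {}wp : cm w < cm p.
  rewrite lt_neqAle wp andbT; apply/eqP => /same_cm_unit[e e1 we].
  by have := eg e e1; rewrite -we ltNge (le_trans gw (ltW zq)).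
have z0 : z != 0.
  by apply/eqP => z0; move: wp; rewrite wf z0 ltxx.
have [u u1 wu] := same_cm_unit wf.
have az := disc_le (ltW zq) aq.
have ufc : ctends (cnbhs z) (fun x => u * f x) (u * f z).
  exact: ctendsM (ctends_cst _) (fc z (ltW zq)).
have wE : u * f z = w by rewrite mulrC -wu.
rewrite wE in ufc.
have Gc : ctends (cnbhs z) (fun x => g (u * f x)) (g w).
  exact: (ctends_compose ufc (gc w (ltW wp))).
have ext : \forall x \near cnbhs z, cm z < cm x -> cm x < cm (g (u * f x)).
  apply: filterS2 (near_cm_lt zq) (ctends_comp ufc (near_cm_lt wp)) => x xq xp zx.
  rewrite ltNge; apply/negP => le.
  have Px : P x (u * f x) by split; rewrite ?(ltW xq) ?(ltW xp) // cmM u1 mul1r.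
  by have := zmax _ _ Px; rewrite leNgt zx.
have gwz : cm (g w) = cm z.
  apply/eqP; rewrite eq_le gw /= leNgt; apply/negP => lt.
  have near2 : \forall x \near cnbhs z, cm (g (u * f x)) < cm z.
    exact: (ctends_comp Gc (near_cm_lt lt)).
  have [d d0 dP] := near_cmp (filterI ext near2).
  have [t [t0 _ ts _]] := @small_pos R (cm z) 0 d 1 (cm_ge0 _) (lexx _) d0 ltr01.
  have [|] := dP (z + t%:C * (z * 1)).
    by rewrite addrC addKr mulr1 cmM cm_real gtr0_norm.
  have zx : cm z < cm (z + t%:C * (z * 1)) by rewrite cm_scale_gt.
  by move=> /(_ zx) h1 h2; have := lt_trans (lt_trans h1 h2) zx; rewrite ltxx.
have [v v1 zv] := same_cm_unit (esym gwz).
have h1 := iwc_comp (iwc_comp (iwc_comp hf (iwc_rot b u1)) hg) (iwc_rot a v1).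
apply: (iwc_fixed_not_extremal a0 h1 az z0) => /=.
  by rewrite wE mulrC -zv.
by apply: filterS ext => x; rewrite cmM v1 mul1r.
Qed.

End TwoMaps.

Theorem comparable_of_iwc a b lf f Mf lg g Mg :
  (forall n, 0 < a n) -> (forall n, 0 < b n) -> disc a 0 -> disc b 0 ->
  iwc a b lf f Mf -> iwc b a lg g Mg -> comparable a b.
Proof.
move=> a0 b0 Da Db hf hg.
have [//|eg] := common_or_expanding a0 b0 Da Db hf hg.
have [/(comparable_sym b0 a0)//|ef] := common_or_expanding b0 a0 Db Da hg hf.
by case: (not_both_expanding a0 b0 Da Db hf hg eg ef).
Qed.

End CommonPoint.

(** * The bounded inverse theorem *)

Section BoundedInverse.
Variable R : realType.

Record complete_norm (V : lmodType R[i]) (n : V -> R) : Prop := {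
  cn_ge0 : forall x, 0 <= n x;
  cn_D : forall x y, n (x + y) <= n x + n y;
  cn_Z : forall (r : R) x, n (r%:C *: x) = `|r| * n x;
  cn_eq0 : forall x, n x = 0 -> x = 0;
  cn_cvg : forall u : nat -> V,
    (forall e : R, 0 < e -> exists N, forall i j, (N <= i)%N -> (N <= j)%N ->
       n (u i - u j) < e) ->
    exists l, forall e : R, 0 < e -> exists N, forall i, (N <= i)%N ->
       n (u i - l) < e }.

Lemma half_geometric_small (c e : R) : 0 < e -> exists j, c * (1 / 2) ^+ j < e.
Proof.
move=> e0; have k1 : `|1 / 2 : R| < 1 by rewrite ger0_norm ?divr_ge0 //; lra.
have : c * (1 / 2) ^+ j @[j --> \oo] --> (0 : R).
  rewrite -[X in _ --> X](mulr0 c).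
  by apply: cvgM; [exact: cvg_cst|exact: cvg_expr].
by move/cvgr_lt => /(_ e e0) [N _ /(_ N (leqnn N))]; exists N.
Qed.

Section NormFacts.
Variables (V : lmodType R[i]) (n : V -> R) (Hn : complete_norm n).

Lemma cn_N x : n (- x) = n x.
Proof.
have := cn_Z Hn (-1) x; rewrite rmorphN rmorph1 scaleN1r => ->.
by rewrite normrN1 mul1r.
Qed.

Lemma cn_B x y : n (x - y) <= n x + n y.
Proof. by rewrite -[n y]cn_N (cn_D Hn). Qed.

Lemma cn_BC x y : n (x - y) = n (y - x).
Proof. by rewrite -cn_N opprB. Qed.

Lemma cn_0 : n 0 = 0.
Proof. by rewrite -(scale0r (0 : V)) -[0 : R[i]]/(0%:C) (cn_Z Hn) normr0 mul0r. Qed.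

Lemma cn_tri x y z : n (x - z) <= n (x - y) + n (y - z).
Proof. by apply: le_trans (cn_D Hn _ _); rewrite addrA subrK. Qed.

(** The completeness argument shared by the Baire step of the next theorem and by
    the summation of its successive corrections. *)
Lemma nested_balls (x : nat -> V) (r : nat -> R) :
  (forall k, 0 < r k) -> (forall k, r k.+1 <= r k / 2) ->
  (forall k, n (x k.+1 - x k) + r k.+1 <= r k) ->
  exists l, forall k, n (l - x k) <= r k.
Proof.
move=> r0 rh xr.
have nest k m : n (x (k + m)%N - x k) + r (k + m)%N <= r k.
  elim: m => [|m IH]; first by rewrite addn0 subrr cn_0 add0r.
  have := cn_tri (x (k + m.+1)%N) (x (k + m)%N) (x k).
  by rewrite addnS; have := xr (k + m)%N; lra.
have rk k : r k <= r 0%N * (1 / 2) ^+ k.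
  elim: k => [|k IH]; first by rewrite expr0 mulr1.
  by apply: le_trans (rh k) _; rewrite exprSr; lra.
have rlim (e : R) : 0 < e -> exists N, r N < e.
  move=> /(half_geometric_small (r 0%N))[N h].
  by exists N; apply: le_lt_trans (rk N) h.
have nest' k i : (k <= i)%N -> n (x i - x k) <= r k.
  by move=> /subnKC <-; have := nest k (i - k)%N; have := r0 (k + (i - k))%N; lra.
have [e e0|l lP] := cn_cvg Hn (u := x).
  have [N rN] := rlim (e / 2) (divr_gt0 e0 (ltr0Sn _ 1)).
  exists N => i j Ni Nj; have := cn_tri (x i) (x N) (x j).
  by rewrite [n (x N - _)]cn_BC; have := nest' _ _ Ni; have := nest' _ _ Nj; lra.
exists l => k.
suff le_eps (e : R) : 0 < e -> n (l - x k) <= r k + e by apply/ler_addgt0Pr.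
move=> e0; have [N NP] := lP e e0.
have := NP (maxn N k) (leq_maxl _ _); rewrite [n (_ - l)]cn_BC.
have := nest' _ _ (leq_maxr N k).
by have := cn_tri l (x (maxn N k)) (x k); lra.
Qed.

End NormFacts.

(** Bounded inverse theorem.  The seminorm $y\mapsto\|W^{-1}y\|$ is countably
    subadditive, so by a Baire argument one of its sublevel sets is dense in
    some ball; halving the error repeatedly bounds it on that ball. *)
Theorem bounded_inverse (V1 V2 : lmodType R[i]) (n1 : V1 -> R) (n2 : V2 -> R)
    (W : V1 -> V2) (T : V2 -> V1) (M : R) :
  complete_norm n1 -> complete_norm n2 -> {morph W : x y / x + y} ->
  (forall (r : R) x, W (r%:C *: x) = r%:C *: W x) ->
  (forall x, n2 (W x) <= M * n1 x) -> cancel W T -> cancel T W ->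
  exists C, forall y, n1 (T y) <= C * n2 y.
Proof.
move=> H1 H2 WD WZ WM WT TW.
have TD : {morph T : x y / x + y} by move=> x y; apply: (can_inj WT); rewrite WD !TW.
have TZ (r : R) y : T (r%:C *: y) = r%:C *: T y.
  by apply: (can_inj WT); rewrite WZ !TW.
have TN y : T (- y) = - T y.
  by have := TZ (-1) y; rewrite rmorphN rmorph1 !scaleN1r.
have W0 : W 0 = 0 by rewrite -(scale0r (0 : V1)) -[0 : R[i]]/(0%:C) WZ scale0r.
(* otherwise every ball contains a smaller one missing the k-th sublevel set, and
   a point common to balls so chosen for all k lies in none of these sets *)
have [k [x0 [r [r0 dense]]]] : exists (k : nat) x0 (r : R), 0 < r /\
    forall y, n2 (y - x0) < r -> forall e : R, 0 < e ->
      exists2 u, n1 (T u) <= k%:R & n2 (y - u) < e.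
  apply: contrapT => nd.
  have step (a : nat * (V2 * R)) : exists b : V2 * R, 0 < a.2.2 ->
      [/\ 0 < b.2, b.2 <= a.2.2 / 2, n2 (b.1 - a.2.1) + b.2 <= a.2.2 &
       forall u, n2 (u - b.1) <= b.2 -> a.1%:R < n1 (T u)].
    case: a => k [x r] /=; have [r0|r0] := pselect (0 < r); last by exists (x, r).
    apply: contrapT => nb; apply: nd; exists k, x, r; split=> // y yx e e0.
    apply: contrapT => nu; apply: nb.
    pose s := Num.min e (r - n2 (y - x)).
    have s0 : 0 < s by rewrite lt_min e0 subr_gt0.
    have se : s <= e by rewrite ge_min lexx.
    have sr : s <= r - n2 (y - x) by rewrite ge_min lexx orbT.
    have y0 := cn_ge0 H2 (y - x).
    exists (y, s / 2) => _ /=; split; first lra; first lra; first lra.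
    move=> u uy; rewrite ltNge; apply/negP => uk; apply: nu; exists u => //.
    by rewrite (cn_BC H2); lra.
  have [f fP] := choice step.
  pose s := fix s j := if j is i.+1 then f (i, s i) else (0 : V2, 1 : R).
  have s0 j : 0 < (s j).2.
    by elim: j => [|j IH] //=; have [] := fP (j, s j) IH.
  have sP j := fP (j, s j) (s0 j).
  have [l lP] : exists l, forall j, n2 (l - (s j).1) <= (s j).2.
    by apply: nested_balls => // j; have [] := sP j.
  have tl := truncnS_gt (n1 (T l)); move: tl; set J := _.+1 => tl.
  have [_ _ _ /(_ l (lP J.+1)) lt] := sP J.
  by have := lt_trans tl lt; rewrite ltxx.
pose K : R := k%:R + k%:R.
have K0 : 0 <= K by rewrite addr_ge0.
(* differences of approximations of two points of the ball centre it at 0 *)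
have dense0 y (e : R) : n2 y < r -> 0 < e -> exists2 u, n1 (T u) <= K & n2 (y - u) < e.
  move=> yr e0; have e2 : 0 < e / 2 by rewrite divr_gt0.
  have [|u uk uy] := dense (x0 + y) _ _ e2; first by rewrite addrC addKr.
  have [|v vk vx] := dense x0 _ _ e2; first by rewrite subrr (cn_0 H2).
  exists (u - v).
    by rewrite TD TN; apply: le_trans (cn_B H1 _ _) _; rewrite lerD.
  have -> : y - (u - v) = (x0 + y - u) - (x0 - v).
    by rewrite -[x0 + y - u]addrA !opprB [RHS]addrC [RHS]addrA subrK addrCA.
  by apply: le_lt_trans (cn_B H2 _ _) _; lra.
pose h j : R := (1 / 2) ^+ j.
have h0 j : 0 < h j by rewrite exprn_gt0 // divr_gt0.
have hS j : h j.+1 = h j / 2 by rewrite /h exprSr mul1r.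
have step (a : nat * V2) : exists u, n2 a.2 < r * h a.1 ->
    n1 (T u) <= K * h a.1 /\ n2 (a.2 - u) < r * h a.1.+1.
  case: a => j y /=; have [yr|yr] := pselect (n2 y < r * h j); last by exists 0.
  have hi : 0 < (h j)^-1 by rewrite invr_gt0.
  have nZ (V : lmodType R[i]) (n : V -> R) (Hn : complete_norm n) (c : R) x :
      0 < c -> n (c%:C *: x) = c * n x by move=> c0; rewrite (cn_Z Hn) gtr0_norm.
  have [||u uK uy] := @dense0 ((h j)^-1%:C *: y) (r / 2).
  - by rewrite (nZ _ _ H2) // mulrC ltr_pdivrMr.
  - by rewrite divr_gt0.
  exists ((h j)%:C *: u) => _; rewrite TZ (nZ _ _ H1) // mulrC ler_pM2r //; split => //.
  have -> : y - (h j)%:C *: u = (h j)%:C *: ((h j)^-1%:C *: y - u).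
    by rewrite scalerBr scalerA -rmorphM mulfV ?gt_eqF // rmorph1 scale1r.
  by rewrite (nZ _ _ H2) // hS mulrA [r * _]mulrC -mulrA ltr_pM2l.
have [U UP] := choice step.
have small y : n2 y < r -> n1 (T y) <= (K + 1) * 2.
  move=> yr; pose Y := fix Y j := if j is i.+1 then Y i - U (i, Y i) else y.
  have Yr j : n2 (Y j) < r * h j.
    elim: j => [|j IH]; first by rewrite /h expr0 mulr1.
    by have [] := UP (j, Y j) IH.
  have UK j : n1 (T (U (j, Y j))) <= K * h j by have [] := UP (j, Y j) (Yr j).
  pose v := fix v j := if j is i.+1 then v i + T (U (i, Y i)) else 0.
  have vY j : W (v j) = y - Y j.
    elim: j => [|j IH] /=; first by rewrite W0 subrr.
    by rewrite WD IH TW opprB addrA addrAC.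
  have [|||l lP] := nested_balls H1 (x := v) (r := fun j => (K + 1) * 2 * h j).
  - by move=> j; rewrite !mulr_gt0 // ltr_wpDl.
  - by move=> j; rewrite hS mulrA.
  - move=> j /=; rewrite [v j + _]addrC addrK hS.
    by have := UK j; have := h0 j; nra.
  have Wl : W l = y.
    apply/eqP; rewrite -subr_eq0; apply/eqP/(cn_eq0 H2)/eqP.
    rewrite eq_le (cn_ge0 H2) andbT.
    suff le_eps (e : R) : 0 < e -> n2 (W l - y) <= 0 + e by apply/ler_addgt0Pr.
    move=> e0; rewrite add0r.
    have WB x x' : W (x - x') = W x - W x'.
      have WN z : W (- z) = - W z.
        by have := WZ (-1) z; rewrite rmorphN rmorph1 !scaleN1r.
      by rewrite WD WN.
    have [j] := half_geometric_small (`|M| * ((K + 1) * 2) + r) e0.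
    rewrite -/(h j) => jP.
    apply: le_trans (cn_tri H2 _ (W (v j)) _) _; rewrite -WB.
    have -> : W (v j) - y = - Y j by rewrite vY addrAC subrr add0r.
    rewrite (cn_N H2).
    have := WM (l - v j); have := Yr j.
    have : M * n1 (l - v j) <= `|M| * ((K + 1) * 2 * h j).
      apply: (@le_trans _ _ (`|M| * n1 (l - v j))).
        by rewrite ler_wpM2r ?(cn_ge0 H1) // ler_norm.
      by rewrite ler_wpM2l.
    lra.
  have -> : T y = l by rewrite -Wl WT.
  by have := lP 0%N; rewrite /= subr0 /h expr0 mulr1.
exists ((K + 1) * 2 * (2 / r)) => y.
have [y0|y0] := eqVneq (n2 y) 0.
  by rewrite y0 mulr0 (cn_eq0 H2 y0) -(W0) WT (cn_0 H1).
have {}y0 : 0 < n2 y by rewrite lt_neqAle eq_sym y0 (cn_ge0 H2).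
pose c := r / 2 / n2 y; have c0 : 0 < c by rewrite !divr_gt0.
have := small (c%:C *: y); rewrite TZ (cn_Z H2) (cn_Z H1) gtr0_norm //.
have -> : c * n2 y = r / 2 by rewrite /c divfK // gt_eqF.
rewrite -ler_pdivlMl // => hs; apply: le_trans (hs _) _; first lra.
by rewrite /c le_eqVlt; apply/orP; left; apply/eqP; field; rewrite !gt_eqF.
Qed.

End BoundedInverse.

(** * Orthogonal expansions in Hilbert function spaces *)

Section HilbertFunctionSpace.
Variables (R : realType) (X : Type) (H : hfs R X).
Implicit Types (f g u v : H) (c : nat -> R[i]).
Local Notation ip := (hfs_ip H).

Definition rnorm f : R := Re (hfs_norm f).

Lemma hfs_normE f : hfs_norm f = (rnorm f)%:C.
Proof.
by rewrite /rnorm RRe_real // ger0_real // /hfs_norm /dnorm sqrtC_ge0 dnorm_ge0.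
Qed.

Lemma rnorm_ge0 f : 0 <= rnorm f.
Proof.
have : 0 <= hfs_norm f by rewrite /hfs_norm /dnorm sqrtC_ge0 dnorm_ge0.
by rewrite hfs_normE ler0c.
Qed.

Lemma ip_rnorm f : ip f f = (rnorm f ^+ 2)%:C.
Proof. by rewrite rmorphXn /= -hfs_normE /hfs_norm /dnorm sqrtCK. Qed.

Lemma rnorm_eq0 f : rnorm f = 0 -> f = 0.
Proof.
move=> f0; apply/eqP; rewrite -(@dnorm_eq0 _ _ ip) ip_rnorm f0.
by rewrite expr0n.
Qed.

Lemma rnorm_gt0 f : f != 0 -> 0 < rnorm f.
Proof.
move=> f0; rewrite lt_neqAle rnorm_ge0 andbT eq_sym; apply/eqP => /rnorm_eq0 E.
by rewrite E eqxx in f0.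
Qed.

Lemma ip_conj f g : ip f g = (ip g f)^*%R.
Proof. by rewrite hermC expr0 mul1r. Qed.

Lemma ip_eq0C f g : ip f g = 0 -> ip g f = 0.
Proof. by rewrite [ip g f]ip_conj => ->; rewrite conjC0. Qed.

Lemma pythagoras u v : ip u v = 0 -> rnorm (u + v) ^+ 2 = rnorm u ^+ 2 + rnorm v ^+ 2.
Proof.
move=> uv; apply: (@complexI R); rewrite rmorphD /= -!ip_rnorm.
by rewrite linearDl !linearDr /= uv (ip_eq0C uv) addr0 add0r.
Qed.

Lemma rnormZ (a : R[i]) f : rnorm (a *: f) = cm a * rnorm f.
Proof.
apply/eqP; rewrite -(@eqrXn2 _ 2) ?mulr_ge0 ?rnorm_ge0 //; apply/eqP.
apply: (@complexI R); rewrite -ip_rnorm linearZl_LR linearZr_LR /= ip_rnorm.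
by rewrite exprMn [RHS]rmorphM mulrA -normCK; congr (_ * _); rewrite [RHS]rmorphXn.
Qed.

Lemma cm_ip f g : cm (ip f g) <= rnorm f * rnorm g.
Proof.
have [->|g0] := eqVneq g 0.
  by rewrite linear0r cm0 mulr_ge0 ?rnorm_ge0.
have n0 := rnorm_gt0 g0.
have ng : (rnorm g ^+ 2)%:C != 0 :> R[i].
  by rewrite -cm_eq0 cm_real normr_eq0 sqrf_eq0 gt_eqF.
pose a := ip f g / (rnorm g ^+ 2)%:C.
have o : ip (f - a *: g) (a *: g) = 0.
  rewrite linearZr_LR linearBl linearZl_LR /= ip_rnorm /a divfK //.
  by rewrite subrr mulr0.
have := pythagoras o; rewrite subrK rnormZ => E.
rewrite -ler_pdivrMr //.
have <- : cm a * rnorm g = cm (ip f g) / rnorm g.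
  rewrite /a cmM cmV cm_real ger0_norm ?sqr_ge0 //; field.
  by rewrite gt_eqF.
rewrite -(@ler_pXn2r _ 2) ?nnegrE ?mulr_ge0 ?rnorm_ge0 //.
by rewrite E lerDr sqr_ge0.
Qed.

Lemma rnormD f g : rnorm (f + g) <= rnorm f + rnorm g.
Proof.
rewrite -(@ler_pXn2r _ 2) ?nnegrE ?addr_ge0 ?rnorm_ge0 //.
rewrite -lecR -ip_rnorm linearDl !linearDr /= !ip_rnorm.
have fg := cm_ip f g.
have h : ip f g + ip g f <= (2 * (rnorm f * rnorm g))%:C.
  rewrite [ip g f]ip_conj -[_^*%R]/((ip f g)^*%C) addcJ rmorphM rmorph_nat /=.
  rewrite ler_pM2l // lecR; apply: le_trans fg.
  exact: le_trans (ler_norm _) (Re_le_cm _).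
have -> : (rnorm f ^+ 2)%:C + ip f g + (ip g f + (rnorm g ^+ 2)%:C) =
    (rnorm f ^+ 2)%:C + (rnorm g ^+ 2)%:C + (ip f g + ip g f) by ring.
rewrite sqrrD rmorphD rmorphD /= [X in _ <= X]addrAC lerD2l.
by rewrite -mulr_natl.
Qed.

Lemma hfs_complete_norm : complete_norm rnorm.
Proof.
split.
- exact: rnorm_ge0.
- exact: rnormD.
- by move=> r f; rewrite rnormZ cm_real.
- exact: rnorm_eq0.
- move=> u uC.
  have real_eps (e : R[i]) : 0 < e -> e = (Re e)%:C /\ 0 < Re e.
    move=> e0; have eE : e = (Re e)%:C by rewrite RRe_real // gtr0_real.
    by split => //; move: e0; rewrite {1}eE ltcR.
  have [e /real_eps[eE e0]|l lP] := @hfs_complete R X H u.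
    have [N NP] := uC _ e0; exists N => i j Ni Nj.
    by rewrite -/(hfs_norm _) hfs_normE eE ltcR NP.
  exists l => e e0; have [|N NP] := lP e%:C; first by rewrite ltcR.
  by exists N => i /NP; rewrite -/(hfs_norm _) hfs_normE ltcR.
Qed.

Lemma rnorm_tri u v f : rnorm (u - f) <= rnorm (u - v) + rnorm (v - f).
Proof. exact: cn_tri hfs_complete_norm _ _ _. Qed.

Lemma eval_bounded (x : X) : exists2 M : R, 0 <= M &
  forall f, cm (hfs_eval H f x) <= M * rnorm f.
Proof.
have [M MP] := hfs_eval_bounded H x; exists `|M| => // f.
have := MP f; rewrite -/(hfs_norm f) hfs_normE -rmorphM.
rewrite -[`|_|]/((cm (hfs_eval H f x))%:C) lecR => /le_trans; apply.
by rewrite ler_wpM2r ?rnorm_ge0 // ler_norm.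
Qed.

Lemma evalB f g (x : X) : hfs_eval H (f - g) x = hfs_eval H f x - hfs_eval H g x.
Proof. by rewrite linearB. Qed.

Section OrthogonalSequence.
Variable E : nat -> H.
Hypothesis E0 : forall n, E n != 0.
Hypothesis Eo : forall n m, n != m -> ip (E n) (E m) = 0.

Definition partial c N : H := \sum_(k < N) c k *: E k.

Lemma partialS c N : partial c N.+1 = partial c N + c N *: E N.
Proof. by rewrite /partial big_ord_recr. Qed.

Lemma ip_partial_orth c N g : (forall n, ip (E n) g = 0) -> ip (partial c N) g = 0.
Proof.
move=> Eg; elim: N => [|N IH]; first by rewrite /partial big_ord0 linear0l.
by rewrite partialS linearDl linearZl_LR /= IH Eg mulr0 addr0.
Qed.

Lemma ip_partial c N m :
  ip (partial c N) (E m) = if (m < N)%N then c m * (rnorm (E m) ^+ 2)%:C else 0.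
Proof.
elim: N => [|N IH]; first by rewrite /partial big_ord0 linear0l.
rewrite partialS linearDl linearZl_LR /= IH ltnS.
have [->|mN] := eqVneq m N; first by rewrite ltnn leqnn add0r ip_rnorm.
rewrite Eo 1?eq_sym // mulr0 addr0 [in RHS]leq_eqVlt (negbTE mN) //.
Qed.

Definition wsum c N : R := \sum_(k < N) cm (c k) ^+ 2 * rnorm (E k) ^+ 2.

Lemma wsumS c N : wsum c N.+1 = wsum c N + cm (c N) ^+ 2 * rnorm (E N) ^+ 2.
Proof. by rewrite /wsum big_ord_recr. Qed.

Lemma rnorm_partialB c N m :
  rnorm (partial c (N + m)%N - partial c N) ^+ 2 = wsum c (N + m)%N - wsum c N.
Proof.
elim: m => [|m IH].
  by rewrite addn0 !subrr (cn_0 hfs_complete_norm) expr0n.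
rewrite addnS partialS wsumS addrAC pythagoras; last first.
  rewrite linearZr_LR linearBl /= !ip_partial ltnn ltnNge leq_addr /=.
  by rewrite subrr mulr0.
by rewrite IH rnormZ exprMn addrAC.
Qed.

Lemma rnorm_partial c N : rnorm (partial c N) ^+ 2 = wsum c N.
Proof.
have := rnorm_partialB c 0 N; rewrite add0n /partial /wsum !big_ord0 !subr0.
by [].
Qed.

Lemma wsum_nondecreasing c : nondecreasing_seq (wsum c).
Proof.
apply/nondecreasing_seqP => n; rewrite wsumS lerDl.
by rewrite mulr_ge0 // sqr_ge0.
Qed.

Definition converges_to c l :=
  forall e : R, 0 < e -> exists N0, forall N, (N0 <= N)%N -> rnorm (partial c N - l) < e.

Lemma riesz_fischer c (B : R) : 0 <= B -> (forall N, wsum c N <= B ^+ 2) ->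
  exists2 l, converges_to c l & rnorm l <= B.
Proof.
move=> B0 cB.
have [L LP] : exists L : R, wsum c @ \oo --> L.
  apply/cvg_ex; apply: nondecreasing_is_cvgn; first exact: wsum_nondecreasing.
  by exists (B ^+ 2) => _ [N _ <-].
have wL N : wsum c N <= L.
  rewrite -(cvg_lim _ LP) //; apply: nondecreasing_cvgn_le.
    exact: wsum_nondecreasing.
  by apply/cvg_ex; exists L.
have cauchy (e : R) : 0 < e -> exists N, forall m, rnorm (partial c (N + m)%N - partial c N) < e.
  move=> e0; have e2 : 0 < e ^+ 2 by rewrite exprn_gt0.
  have /cvgrPdist_lt /(_ _ e2) [N _ /(_ N (leqnn N))] /= := LP.
  rewrite ger0_norm ?subr_ge0 // => h; exists N => m.
  rewrite -(@ltr_pXn2r _ 2) ?nnegrE ?rnorm_ge0 ?(ltW e0) // rnorm_partialB.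
  by have := wL (N + m)%N; lra.
have [e e0|l lP] := cn_cvg hfs_complete_norm (u := partial c).
  have [N NP] := cauchy (e / 2) (divr_gt0 e0 (ltr0Sn _ 1)).
  exists N => i j /subnKC <- /subnKC <-.
  have := rnorm_tri (partial c (N + (i - N))%N) (partial c N) (partial c (N + (j - N))%N).
  rewrite [rnorm (partial c N - _)](cn_BC hfs_complete_norm).
  by have := NP (i - N)%N; have := NP (j - N)%N; lra.
exists l => //.
suff le_eps (e : R) : 0 < e -> rnorm l <= B + e by apply/ler_addgt0Pr.
move=> e0; have [N NP] := lP e e0; have := NP N (leqnn N).
have pB : rnorm (partial c N) <= B.
  by rewrite -(@ler_pXn2r _ 2) ?nnegrE ?rnorm_ge0 // rnorm_partial.
have := cn_B hfs_complete_norm (partial c N) (partial c N - l).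
by rewrite opprB addrCA subrr addr0; lra.
Qed.

Lemma converges_ip c l g (w : R[i]) : converges_to c l ->
  (\forall N \near \oo, ip (partial c N) g = w) -> ip l g = w.
Proof.
move=> cl [N1 _ h]; apply/eqP; rewrite -subr_eq0 -cm_eq0 eq_le cm_ge0 andbT.
suff le_eps (e : R) : 0 < e -> cm (ip l g - w) <= 0 + e by apply/ler_addgt0Pr.
move=> e0; rewrite add0r.
have g1 : 0 < rnorm g + 1 by rewrite ltr_wpDl ?rnorm_ge0.
have [N0 NP] := cl _ (divr_gt0 e0 g1).
have := NP (maxn N0 N1) (leq_maxl _ _); rewrite ltr_pdivlMr // => lt.
rewrite cmBC -(h (maxn N0 N1) (leq_maxr _ _)) -linearBl /=.
apply: le_trans (cm_ip _ _) _; apply: le_trans (ltW lt).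
by rewrite ler_wpM2l ?rnorm_ge0 // lerDl.
Qed.

Lemma converges_coef c l m : converges_to c l ->
  ip l (E m) = c m * (rnorm (E m) ^+ 2)%:C.
Proof.
move=> cl; apply: (converges_ip cl); exists m.+1 => // N /= mN.
by rewrite ip_partial mN.
Qed.

Lemma converges_orth c l g : converges_to c l -> (forall n, ip (E n) g = 0) ->
  ip l g = 0.
Proof.
by move=> cl Eg; apply: (converges_ip cl); apply: nearW => N; apply: ip_partial_orth.
Qed.

Lemma converges_eval c l (x : X) : converges_to c l ->
  ctends \oo (fun N => \sum_(k < N) c k * hfs_eval H (E k) x) (hfs_eval H l x).
Proof.
move=> cl; have [M M0 MP] := eval_bounded x.
have pE N : \sum_(k < N) c k * hfs_eval H (E k) x = hfs_eval H (partial c N) x.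
  elim: N => [|N IH]; first by rewrite big_ord0 /partial big_ord0 linear0.
  by rewrite big_ord_recr partialS linearD linearZ /= IH.
apply/ctends_eps => e e0.
have M1 : 0 < M + 1 by rewrite ltr_wpDl.
have [N0 NP] := cl _ (divr_gt0 e0 M1); exists N0 => // N /= /NP.
rewrite ltr_pdivlMr // pE -evalB => lt.
apply: le_lt_trans (MP _) _; apply: le_lt_trans lt.
by rewrite mulrC ler_wpM2l ?rnorm_ge0 // lerDl.
Qed.

Definition fourier f n : R[i] := ip f (E n) / (rnorm (E n) ^+ 2)%:C.

Lemma fourierK f n : fourier f n * (rnorm (E n) ^+ 2)%:C = ip f (E n).
Proof.
rewrite /fourier divfK // -cm_eq0 cm_real normr_eq0 sqrf_eq0.
by rewrite gt_eqF // rnorm_gt0.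
Qed.

Lemma bessel f N : wsum (fourier f) N <= rnorm f ^+ 2.
Proof.
set p := partial (fourier f) N.
have fp m : (m < N)%N -> ip (f - p) (E m) = 0.
  by move=> mN; rewrite linearBl /= ip_partial mN fourierK subrr.
have fpp : ip (f - p) p = 0.
  apply: ip_eq0C.
  suff h k : (k <= N)%N -> ip (partial (fourier f) k) (f - p) = 0 by apply: h.
  elim: k => [|k IH] kN; first by rewrite /partial big_ord0 linear0l.
  rewrite partialS linearDl linearZl_LR /= IH ?(ltnW kN) //.
  by rewrite (ip_eq0C (fp k kN)) mulr0 addr0.
have := pythagoras fpp; rewrite subrK => ->; rewrite rnorm_partial lerDr.
exact: sqr_ge0.
Qed.

Lemma projection f : exists2 l, converges_to (fourier f) l &
  forall n, ip (f - l) (E n) = 0.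
Proof.
have [l fl _] := riesz_fischer (rnorm_ge0 f) (bessel f).
exists l => // n. by rewrite linearBl /= (converges_coef _ fl) fourierK subrr.
Qed.

End OrthogonalSequence.
End HilbertFunctionSpace.

(** * Weighted Hardy spaces along a coordinate axis *)

Section Axis.
Variable R : realType.
Implicit Types (t s z : R[i]) (a b : nat -> R).

Definition axis_point d (i : 'I_d) t : 'rV[R[i]]_d :=
  \row_j (if j == i then t else 0).

Definition axis_exp d (i : 'I_d) n : {ffun 'I_d -> nat} :=
  [ffun j => if j == i then n else 0%N].

Lemma monomial_axis d (i : 'I_d) n t :
  monomial (axis_exp i n) (axis_point i t) = t ^+ n.
Proof.
rewrite /monomial (bigD1 i) //= big1 => [|j ji].
  by rewrite !mxE !ffunE eqxx mulr1.
by rewrite !mxE !ffunE (negbTE ji) expr0.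
Qed.

Lemma monomial_off_axis d (i : 'I_d) al t : (forall n, al != axis_exp i n) ->
  monomial al (axis_point i t) = 0.
Proof.
move=> h; have [j ji aj] : exists2 j, j != i & al j != 0%N.
  apply: contrapT => none; have /negP := h (al i); apply; apply/eqP/ffunP => j.
  rewrite ffunE; case: eqP => [->//|/eqP ji]; apply/eqP; apply: contraT => aj.
  by exfalso; apply: none; exists j.
rewrite /monomial (bigD1 j) //= !mxE (negbTE ji).
by rewrite expr0n (negbTE aj) mul0r.
Qed.

Lemma axis_exp_inj d (i : 'I_d) n m : n != m -> axis_exp i n != axis_exp i m.
Proof.
move=> nm; apply/eqP => /ffunP /(_ i); rewrite !ffunE eqxx => E.
by rewrite E eqxx in nm.
Qed.

Lemma axis_exp_neq d (i j : 'I_d) n : j != i -> forall m, axis_exp j n.+1 != axis_exp i m.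
Proof.
move=> ji m; apply/eqP => /ffunP /(_ j).
by rewrite !ffunE eqxx (negbTE ji).
Qed.

Lemma dotmx_axis d (i : 'I_d) t s :
  dotmx (axis_point i t) (axis_point i s) = t * s^*%R.
Proof.
rewrite dotmxE mxE (bigD1 i) //= big1 => [|j ji].
  by rewrite !mxE eqxx addr0.
by rewrite !mxE (negbTE ji) mul0r.
Qed.

Lemma sqr_enorm_axis d (i : 'I_d) t : sqr_enorm (axis_point i t) = cm t ^+ 2.
Proof.
rewrite /sqr_enorm dotmx_axis -normCK -[`|t|]/((cm t)%:C) -rmorphXn.
by [].
Qed.

Lemma disc_conv_radius b t : (forall n, 0 < b n) ->
  disc b t <-> ((cm t ^+ 2)%:E < conv_radius b)%E.
Proof.
move=> b0; split.
  move=> [r [K [tr bK]]]; have r0 := le_lt_trans (cm_ge0 t) tr.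
  pose s := (cm t ^+ 2 + r ^+ 2) / 2.
  have tr2 : cm t ^+ 2 < r ^+ 2 by rewrite ltr_pXn2r ?nnegrE // ltW.
  have t2 : 0 <= cm t ^+ 2 by rewrite sqr_ge0.
  have ts : cm t ^+ 2 < s by rewrite /s; lra.
  have sr : s < r ^+ 2 by rewrite /s; lra.
  have r2 : 0 < r ^+ 2 by lra.
  apply: (@lt_le_trans _ _ s%:E); first by rewrite lte_fin.
  apply: ereal_sup_ubound; exists s => //; split; first lra.
  apply: (@geometric_dominated_cvg _ _ K (s / r ^+ 2)).
    by rewrite divr_ge0 ?ltr_pdivrMr ?mul1r //=; lra.
  move=> n; have s0 : 0 <= s by lra.
  rewrite ger0_norm ?mulr_ge0 ?exprn_ge0 ?(ltW (b0 n)) //.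
  rewrite expr_div_n mulrA ler_pdivlMr ?exprn_gt0 // mulrAC.
  by rewrite ler_wpM2r ?exprn_ge0 // exprAC.
move=> /ereal_sup_gt[_ [s [s0 cs] <-]]; rewrite lte_fin => ts.
have cmt : cm t < Num.sqrt s.
  by rewrite -(@ltr_pXn2r _ 2) ?nnegrE ?sqrtr_ge0 // sqr_sqrtr.
have [K [_ KP]] := cvg_seq_bounded (cvgP _ (cvg_series_cvg_0 cs)).
exists (Num.sqrt s), (K + 1); split => // n.
have := KP (K + 1); rewrite ltrDl => /(_ ltr01 n I) /=.
rewrite exprAC sqr_sqrtr // ger0_norm // mulr_ge0 ?exprn_ge0 ?(ltW (b0 n)) //.
Qed.

End Axis.

Section AxisSeries.
Variables (R : realType) (d : nat) (i : 'I_d) (b : nat -> R).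
Variables (H : hfs R (hardy_domain b d)) (hH : weighted_hardy_space H).
Implicit Types (f g : H) (t : R[i]) (x : hardy_domain b d) (c : nat -> R[i]).

Lemma wh_gt0 n : 0 < b n. Proof. by have [_] := wh_generating hH. Qed.

Lemma wh_disc0 : disc b 0.
Proof.
by apply/(disc_conv_radius _ wh_gt0); rewrite cm0 expr0n; have [_ _] := wh_generating hH.
Qed.

Lemma axis_point_exists t : exists x, disc b t -> val x = axis_point i t.
Proof.
have mem s : disc b s -> axis_point i s \in hardy_domain b d.
  move=> /(disc_conv_radius _ wh_gt0) ds; rewrite inE; left.
  by rewrite /hardy_ball /= sqr_enorm_axis.
have [dt|nt] := pselect (disc b t); first by exists (SigSub (mem _ dt)).
by exists (SigSub (mem _ wh_disc0)).
Qed.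

(** Off the axis the monomials vanish at points of the axis, so the kernel at
    such a point lies in the closed span of the powers of one coordinate. *)
Lemma axis_monomials : exists E : nat -> H,
  [/\ forall n, E n != 0, forall n m, n != m -> hfs_ip H (E n) (E m) = 0,
      forall n t x, val x = axis_point i t -> hfs_eval H (E n) x = t ^+ n,
      forall (j : 'I_d) t x, j != i -> val x = axis_point j t ->
        forall n, hfs_eval H (E n.+1) x = 0 &
      forall t x, val x = axis_point i t ->
        exists k : H, [/\ hfs_eval H k x = gen_fun b (t * t^*%R),
         forall f, hfs_eval H f x = hfs_ip H f k &
         converges_to E (fourier E k) k]].
Proof.
have [e [eE [e0 eo ecomp _ _]]] := wh_monomials hH.
pose E n := e (axis_exp i n).
have E0 n : E n != 0 by apply: e0.
have Eo n m : n != m -> hfs_ip H (E n) (E m) = 0.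
  by move=> nm; apply/eo/axis_exp_inj.
have Ee n t x : val x = axis_point i t -> hfs_eval H (E n) x = t ^+ n.
  by move=> xt; rewrite eE xt monomial_axis.
exists E; split => //.
  move=> j t x ji xt n; rewrite eE xt monomial_off_axis // => m.
  by apply: axis_exp_neq; rewrite eq_sym.
move=> t x xt; have [k [kE kP]] := wh_kernel hH x.
have [l kl lo] := projection E0 Eo k.
have kl0 : k - l = 0.
  apply: ecomp => al.
  have [[n ->]|off] := pselect (exists n, al = axis_exp i n); first exact: lo.
  have offn n : al != axis_exp i n by apply/eqP => aln; apply: off; exists n.
  have ka : hfs_ip H k (e al) = 0.
    by apply: ip_eq0C; rewrite -kP eE xt monomial_off_axis.
  rewrite linearBl /= ka sub0r; apply/eqP; rewrite oppr_eq0; apply/eqP.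
  by apply: (converges_orth kl) => n; apply: eo; rewrite eq_sym.
exists k; split => //.
  by rewrite kE xt dotmx_axis.
by rewrite {2}(subr0_eq kl0).
Qed.

Lemma gen_fun_real (s : R) : cvgn (pseries b s) -> gen_fun b s%:C = (limn (pseries b s))%:C.
Proof.
move=> cs; rewrite /gen_fun.
have h : (series (fun n => (b n)%:C * s%:C ^+ n) : nat -> R[i]^o) @ \oo
    --> ((limn (pseries b s))%:C : R[i]^o).
  apply/cvgrPdist_lt => e e0.
  have eE : e = (Re e)%:C by rewrite RRe_real // gtr0_real.
  have re0 : 0 < Re e by move: e0; rewrite {1}eE ltcR.
  have /cvgrPdist_lt /(_ _ re0) := cs.
  apply: filterS => n h; rewrite eE.
  have -> : series (fun n => (b n)%:C * s%:C ^+ n) n = (pseries b s n)%:C.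
    rewrite /pseries /series /= rmorph_sum /=; apply: eq_bigr => j _.
    by rewrite rmorphM rmorphXn.
  rewrite -[`|_|]/((cm ((limn (pseries b s))%:C - (pseries b s n)%:C))%:C).
  by rewrite ltcR -rmorphB cm_real.
exact: (cvg_lim _ h).
Qed.

(** On the diagonal of the axis the kernel has two expansions, by the generating
    function and by the orthogonal powers of the coordinate; power series
    agreeing at small positive numbers have the same coefficients. *)
Lemma norm_monomial E : (forall n, E n != 0) ->
  (forall n m, n != m -> hfs_ip H (E n) (E m) = 0) ->
  (forall n t x, val x = axis_point i t -> hfs_eval H (E n) x = t ^+ n) ->
  (forall t x, val x = axis_point i t ->
        exists k : H, [/\ hfs_eval H k x = gen_fun b (t * t^*%R),
         forall f, hfs_eval H f x = hfs_ip H f k &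
         converges_to E (fourier E k) k]) ->
  forall n, rnorm (E n) ^+ 2 = (b n)^-1.
Proof.
move=> E0 Eo Ee Ek.
have N0 n : 0 < rnorm (E n) ^+ 2 by rewrite exprn_gt0 // rnorm_gt0.
have [r [K [r0 bK]]] := wh_disc0; rewrite cm0 in r0.
(* at real points of the axis the kernel series has real terms, so that its sum
   is that of the real generating function *)
have key (t : R) : 0 < t -> t < r ->
    ctends \oo (psum (fun n => ((rnorm (E n) ^+ 2)^-1)%:C) (t ^+ 2)%:C)
     (ps (fun n => (b n)%:C) (t ^+ 2)%:C) /\
    exists B, forall n, (rnorm (E n) ^+ 2)^-1 * (t ^+ 2) ^+ n <= B.
  move=> t0 tr; have dt : disc b t%:C.
    by exists r, K; rewrite cm_real gtr0_norm.
  have [x /(_ dt) xt] := axis_point_exists t%:C.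
  have [k [kE kP kc]] := Ek _ _ xt.
  have fk n : fourier E k n = ((rnorm (E n) ^+ 2)^-1 * t ^+ n)%:C.
    rewrite /fourier ip_conj -kP (Ee n t%:C) //.
    have -> : ((t%:C : R[i]) ^+ n)^*%R = (t ^+ n)%:C.
      by rewrite -rmorphXn; exact: conjc_real.
    by rewrite [RHS]rmorphM [X in _ = X * _]fmorphV mulrC.
  have tt : t%:C * (t%:C)^*%R = (t ^+ 2)%:C :> R[i].
    by rewrite -[(t%:C)^*%R]/(conjc t%:C) conjc_real -rmorphM.
  have trc : (t ^+ 2)%:E%E = ((cm (t%:C : R[i])) ^+ 2)%:E by rewrite cm_real gtr0_norm.
  have [s [[s0 cs] ts]] : exists s, (0 <= s /\ cvgn (pseries b s)) /\ t ^+ 2 < s.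
    move: dt => /(disc_conv_radius _ wh_gt0); rewrite -trc.
    by move=> /ereal_sup_gt[_ [s s0 <-]]; rewrite lte_fin => ts; exists s.
  have ct : cvgn (pseries b (t ^+ 2)).
    apply: is_cvg_pseries_inside cs _.
    by rewrite !ger0_norm // sqr_ge0.
  split; last first.
    exists (rnorm k ^+ 2) => n; apply: le_trans (bessel E0 Eo k n.+1).
    rewrite wsumS fk cm_real ger0_norm; last first.
      by rewrite mulr_ge0 ?invr_ge0 ?(ltW (N0 n)) ?exprn_ge0 ?(ltW t0).
    rewrite -[leLHS]add0r lerD //; first by apply: sumr_ge0 => m _; rewrite mulr_ge0 ?sqr_ge0.
    rewrite le_eqVlt; apply/orP; left; apply/eqP.
    by rewrite exprAC; move: (N0 n) (t ^+ n) => h u; field; rewrite gt_eqF // rnorm_gt0.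
  have -> : ps (fun n => (b n)%:C) (t ^+ 2)%:C = hfs_eval H k x.
    rewrite kE tt gen_fun_real //; apply: ps_unique.
    have -> : psum (fun n => (b n)%:C) (t ^+ 2)%:C = (fun N => (pseries b (t ^+ 2) N)%:C).
      apply/funext => N; rewrite /psum /pseries /series /= rmorph_sum big_mkord.
      apply: eq_bigr => m _; rewrite [RHS]rmorphM; congr (_ * _).
      by rewrite [RHS]rmorphXn.
    by split => /=; [exact: ct|exact: cvg_cst].
  apply: ctends_ext (converges_eval x kc) => N; apply: eq_bigr => m _.
  rewrite fk (Ee m t%:C) // -[in LHS]rmorphXn -[LHS]rmorphM /= -mulrA -expr2 exprAC.
  by rewrite [LHS]rmorphM; congr (_ * _); rewrite [LHS]rmorphXn.
(* the factor 1 only gives the difference the shape of [psB] *)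
pose c n : R[i] := (b n)%:C - 1 * ((rnorm (E n) ^+ 2)^-1)%:C.
pose r1 := Num.min 1 (r / 2); pose r2 := r1 ^+ 2.
have r1r : r1 < r by rewrite gt_min; apply/orP; right; lra.
have r10 : 0 < r1 by rewrite lt_min ltr01 divr_gt0.
have r11 : r1 <= 1 by rewrite ge_min lexx.
have r20 : 0 < r2 by rewrite exprn_gt0.
have [_ [B BP]] := key r1 r10 r1r.
have bB : pbound (fun n => (b n)%:C) r2 K.
  move=> n; rewrite cm_real gtr0_norm ?wh_gt0 //; apply: le_trans (bK n).
  rewrite ler_pM2l ?wh_gt0 // /r2 exprAC.
  by rewrite !lerXn2r ?nnegrE ?exprn_ge0 ?(ltW r0) ?(ltW r10) ?(ltW r1r).
have eB : pbound (fun n => ((rnorm (E n) ^+ 2)^-1)%:C) r2 B.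
  by move=> n; rewrite cm_real gtr0_norm ?invr_gt0.
have cB := pboundB 1 (ltW r20) bB eB.
have c0 (s : R) : 0 < s -> s < r2 -> ps c s%:C = 0.
  move=> s0 sr; have ss : (Num.sqrt s) ^+ 2 = s by rewrite sqr_sqrtr // ltW.
  have sl : Num.sqrt s < r.
    apply: lt_trans r1r; rewrite -(@ltr_pXn2r _ 2) ?nnegrE ?sqrtr_ge0 ?(ltW r10) //.
    by rewrite ss.
  have s1 : 0 < Num.sqrt s by rewrite sqrtr_gt0.
  have [+ _] := key _ s1 sl; rewrite ss => h.
  have sm : cm (s%:C : R[i]) < r2 by rewrite cm_real gtr0_norm.
  by rewrite /c (psB _ bB eB sm) (ps_unique h) mul1r subrr.
have cz : cm (0 : R[i]) < r2 by rewrite cm0.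
have call n : c n = 0.
  have [[k [g [K' [gK g0 gE]]]]|flat] := ps_order_infinite cB cz.
    exfalso; have near1 : \forall z \near cnbhs 0, ps g z != 0.
      exact: ctends_neq0 g0 (ps_continuous gK cz).
    have [e e0 eP] := near_cmp near1.
    have [t [t0 _ te tr]] := @small_pos R 1 1 e r2 ler01 ler01 e0 r20.
    rewrite mulr1 in te; rewrite mulr1 in tr.
    have tC : cm (t%:C : R[i]) = t by rewrite cm_real gtr0_norm.
    have := gE t%:C; rewrite tC => /(_ tr); rewrite (c0 t) // subr0 => /esym/eqP.
    rewrite mulf_eq0 expf_eq0 -cm_eq0 tC gt_eqF // andbF /=.
    by apply/negP/eP; rewrite subr0 tC.
  apply: (ps_lead_coef r20 cB (G := fun=> 0)); last exact: ctends_cst.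
  rewrite cm0 subr0 in flat.
  apply: filterS (near_ball 0 r20) => z zr _.
  by rewrite mulr0; apply: flat.
move=> n; have := call n; rewrite /c mul1r => /eqP; rewrite subr_eq0 => /eqP.
by move/complexI => ->; rewrite invrK.
Qed.

(** Functions on the axis correspond to weighted square-summable sequences; in
    one variable this describes the whole space. *)
Lemma axis_series : exists E : nat -> H,
  [/\ forall n t x, val x = axis_point i t -> hfs_eval H (E n) x = t ^+ n,
   forall (j : 'I_d) t x, j != i -> val x = axis_point j t ->
        forall n, hfs_eval H (E n.+1) x = 0,
   forall f, exists2 c, l2_le b c (rnorm f) &
     forall t x, disc b t -> val x = axis_point i t -> hfs_eval H f x = ps c t &
   forall c (B : R), l2_le b c B -> exists2 f, rnorm f <= B &
     forall t x, disc b t -> val x = axis_point i t -> hfs_eval H f x = ps c t].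
Proof.
have [E [E0 Eo Ee Eoff Ek]] := axis_monomials.
have EN := norm_monomial E0 Eo Ee Ek.
have wsE c N : wsum E c N = \sum_(n < N) cm (c n) ^+ 2 / b n.
  by apply: eq_bigr => n _; rewrite EN.
have ev c l t x : converges_to E c l -> val x = axis_point i t ->
    hfs_eval H l x = ps c t.
  move=> cl xt; apply/esym/ps_unique.
  by apply: ctends_ext (converges_eval x cl) => N; apply: eq_bigr => n _; rewrite (Ee n t).
exists E; split => //.
  move=> f; have [l fl lo] := projection E0 Eo f.
  exists (fourier E f).
    by split => [|N]; [exact: rnorm_ge0|rewrite -wsE; exact: bessel].
  move=> t x dt xt; rewrite -(ev _ _ _ _ fl xt).
  have [k [_ kP kc]] := Ek _ _ xt.
  apply/eqP; rewrite -subr_eq0 -evalB kP; apply/eqP/ip_eq0C.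
  by apply: (converges_orth kc) => n; apply: ip_eq0C.
move=> c B [B0 cB]; have [|l cl lB] := riesz_fischer Eo B0 (c := c).
  by move=> N; rewrite wsE.
by exists l => // t x _ xt; apply: ev.
Qed.

End AxisSeries.

(** * From weak relations to coefficient sequences *)

Section WeakRelation.
Variables (R : realType) (d : nat) (a b : nat -> R).
Variables (H : hfs R (hardy_domain b d)) (H' : hfs R (hardy_domain a 1)).
Hypotheses (hH : weighted_hardy_space H) (hH' : weighted_hardy_space H').
Variables (Lam : hardy_domain b d -> R[i]).
Variables (Phi : hardy_domain b d -> hardy_domain a 1) (W : H' -> H) (T : H -> H').
Hypothesis hW : weighted_composition Lam Phi W.
Hypotheses (WT : cancel W T) (TW : cancel T W).
Implicit Types (t w : R[i]) (x : hardy_domain b d) (y : hardy_domain a 1).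

Let a0 := wh_gt0 hH'.
Let b0 := wh_gt0 hH.

Lemma rV1_axis (v : 'rV[R[i]]_1) : v = axis_point ord0 (v 0 0).
Proof. by apply/rowP => j; rewrite mxE !ord1 eqxx. Qed.

Lemma wc_eval f x : hfs_eval H (W f) x = Lam x * hfs_eval H' f (Phi x).
Proof. by case: hW. Qed.

Lemma wc_bounded : exists2 M : R, 0 <= M &
  (forall f, rnorm (W f) <= M * rnorm f) /\ forall h, rnorm (T h) <= M * rnorm h.
Proof.
have [_ [M0 M0P]] := hW.
have WB f : rnorm (W f) <= M0 * rnorm f.
  by have := M0P f; rewrite !hfs_normE -rmorphM lecR.
have WD : {morph W : f g / f + g}.
  move=> f g; apply: hfs_eval_inj; apply/funext => x.
  by rewrite linearD /= [RHS]/(_ + _) !wc_eval linearD /= mulrDr.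
have WZ (r : R) f : W (r%:C *: f) = r%:C *: W f.
  apply: hfs_eval_inj; apply/funext => x.
  by rewrite linearZ /= [RHS]/(_ *: _) !wc_eval linearZ /= mulrCA.
have [C CP] := bounded_inverse (hfs_complete_norm H') (hfs_complete_norm H) WD WZ WB WT TW.
exists (`|M0| + `|C|); first by rewrite addr_ge0.
split=> [f|h].
  apply: le_trans (WB f) _; rewrite ler_wpM2r ?rnorm_ge0 //.
  by apply: le_trans (ler_norm _) _; rewrite lerDl.
apply: le_trans (CP h) _; rewrite ler_wpM2r ?rnorm_ge0 //.
by apply: le_trans (ler_norm _) _; rewrite lerDr.
Qed.

Section OnAxis.
Variables (i : 'I_d) (p : R[i] -> hardy_domain b d).
Hypothesis pE : forall t, disc b t -> val (p t) = axis_point i t.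

Definition axis_phi t := val (Phi (p t)) 0 0.
Definition axis_lam t := Lam (p t).

Lemma axis_monomial n : exists h : H',
  forall y, hfs_eval H' h y = val y 0 0 ^+ n.
Proof.
have [E [Ee _ _ _]] := axis_series ord0 hH'.
by exists (E n) => // y; rewrite (Ee n (val y 0 0)) //; exact: rV1_axis.
Qed.

Lemma axis_lam_neq0 t : disc b t -> axis_lam t != 0.
Proof.
move=> dt; have [E [Ee _ _ _]] := axis_series i hH.
have := wc_eval (T (E 0%N)) (p t); rewrite TW (Ee _ _ _ (pE dt)) expr0 => E1.
by apply/eqP => l0; move/eqP: E1; rewrite -/(axis_lam t) l0 mul0r oner_eq0.
Qed.

Lemma axis_lam_series : exists c B, l2_le b c B /\
  forall t, disc b t -> ps c t = axis_lam t.
Proof.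
have [E [_ _ Ec _]] := axis_series i hH.
have [h hE] := axis_monomial 0; have [c cB cE] := Ec (W h).
exists c, (rnorm (W h)); split => // t dt.
by rewrite -(cE t (p t) dt (pE dt)) wc_eval hE expr0 mulr1.
Qed.

Lemma axis_lam_phi_series : exists c B, l2_le b c B /\
  forall t, disc b t -> ps c t = axis_lam t * axis_phi t.
Proof.
have [E [_ _ Ec _]] := axis_series i hH.
have [h hE] := axis_monomial 1; have [c cB cE] := Ec (W h).
exists c, (rnorm (W h)); split => // t dt.
by rewrite -(cE t (p t) dt (pE dt)) wc_eval hE expr1.
Qed.

Lemma axis_phi_continuous t : disc b t -> ctends (cnbhs t) axis_phi (axis_phi t).
Proof.
move=> dt; have [cv [Bv [cvB vE]]] := axis_lam_series.
have [cu [Bu [cuB uE]]] := axis_lam_phi_series.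
have [r [tr rD [K cK]]] := disc_pbound b0 dt.
have E w : disc b w -> ps cu w / ps cv w = axis_phi w.
  by move=> dw; rewrite uE // vE // mulrAC mulfV ?mul1r // axis_lam_neq0.
rewrite -(E t dt); apply: (ctends_near (f := fun w => ps cu w / ps cv w)).
  by apply: filterS (disc_near dt) => w /E.
apply: ctendsM; first exact: ps_continuous (cK _ _ cuB) tr.
apply: ctendsV; first by rewrite vE // axis_lam_neq0.
exact: ps_continuous (cK _ _ cvB) tr.
Qed.

Lemma domain_disc_or_extremal y : disc a (val y 0 0) \/
  forall y', cm (val y' 0 0) <= cm (val y 0 0).
Proof.
have sq (z : hardy_domain a 1) : sqr_enorm (val z) = cm (val z 0 0) ^+ 2.
  by rewrite {1}(rV1_axis (val z)) sqr_enorm_axis.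
have [dy|ny] := pselect (disc a (val y 0 0)); [by left|right => y'].
have le (z : hardy_domain a 1) : ((cm (val z 0 0) ^+ 2)%:E <= conv_radius a)%E.
  by have := set_mem (valP z); rewrite -sq => -[/ltW//|[-> _]]; exact: lexx.
have ge : (conv_radius a <= (cm (val y 0 0) ^+ 2)%:E)%E.
  by rewrite leNgt; apply/negP => /(disc_conv_radius _ a0).
rewrite -(@ler_pXn2r _ 2) ?nnegrE // -lee_fin.
exact: le_trans (le y') ge.
Qed.

(** Boundary points of the disc are not attained: $\varphi$ would have a local
    maximum modulus there, hence be locally constant, although quotients of
    functions in the range of the operator separate points of the axis. *)
Lemma axis_phi_disc t : disc b t -> disc a (axis_phi t).
Proof.
move=> dt; have [//|ext] := domain_disc_or_extremal (Phi (p t)).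
apply: contrapT => nd.
have f0 : axis_phi t != 0.
  by apply/eqP => E; apply: nd; rewrite E; exact: wh_disc0 hH'.
have [cv [Bv [cvB vE]]] := axis_lam_series.
have [cu [Bu [cuB uE]]] := axis_lam_phi_series.
have [r [tr rD [K cK]]] := disc_pbound b0 dt.
have r0 := le_lt_trans (cm_ge0 t) tr.
have dK := pboundB (axis_phi t) (ltW r0) (cK _ _ cuB) (cK _ _ cvB).
have dE w : cm w < r -> ps (fun n => cu n - axis_phi t * cv n) w =
    axis_lam w * (axis_phi w - axis_phi t).
  move=> wr; have dw := rD _ wr.
  by rewrite (psB _ (cK _ _ cuB) (cK _ _ cvB) wr) uE // vE //; ring.
have [[k [g [K' [gK gt gE]]]]|flat] := ps_order_infinite dK tr.
  have k0 : (0 < k)%N.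
    rewrite lt0n; apply/eqP => k0; have := gE t tr.
    rewrite dE // subrr mulr0 k0 expr0 mul1r => /esym/eqP.
    by rewrite (negbTE gt).
  pose Y w := ps g w / axis_lam w / axis_phi t.
  have lc : ctends (cnbhs t) axis_lam (axis_lam t).
    rewrite -(vE t dt); apply: (ctends_near (f := ps cv)).
      by apply: filterS (disc_near dt) => w /vE.
    exact: ps_continuous (cK _ _ cvB) tr.
  have Yt : ctends (cnbhs t) Y (Y t).
    apply: ctendsM; last exact: ctends_cst.
    apply: ctendsM; first exact: ps_continuous gK tr.
    by apply: ctendsV lc; exact: axis_lam_neq0.
  have Yt0 : Y t != 0 by rewrite !mulf_neq0 ?invr_neq0 // axis_lam_neq0.
  have [||s [_ _]] := @modulus_increase R axis_phi Y t (Y t) (k.-root (Y t)^-1) k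
      setT f0 Yt _ (nearW _ (fun=> I)).
  - apply: filterS (near_cm_lt tr) => w wr; have := gE w wr.
    rewrite dE // /Y => E; have l0 := axis_lam_neq0 (rD _ wr).
    have -> : (w - t) ^+ k * (ps g w / axis_lam w / axis_phi t) =
        ((w - t) ^+ k * ps g w) / axis_lam w / axis_phi t by ring.
    by rewrite -E; field; rewrite f0 l0.
  - by rewrite rootCK // mulVf //; exact: ltr01.
  by rewrite ltNge ext.
have rt : 0 < r - cm t by rewrite subr_gt0.
have [E [Ee _ _ _]] := axis_series i hH.
(* the symbol is constant near t; the functions 1 and t on the axis are both in
   the range of the operator *)
have same w : cm (w - t) < r - cm t -> w = t.
  move=> wt; have wr : cm w < r by have := cm_sub w t; lra.
  have dw := rD _ wr.
  have /eqP := flat w wt; rewrite dE // mulf_eq0 (negbTE (axis_lam_neq0 dw)) /=.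
  rewrite subr_eq0 => /eqP wE.
  have pw : Phi (p w) = Phi (p t).
    by apply: val_inj; rewrite [LHS]rV1_axis [RHS]rV1_axis -/(axis_phi w) wE.
  have ev n : w ^+ n * axis_lam t = t ^+ n * axis_lam w.
    have := wc_eval (T (E n)) (p w); have := wc_eval (T (E n)) (p t).
    rewrite !TW (Ee n _ _ (pE dt)) (Ee n _ _ (pE dw)) pw => -> ->.
    by rewrite -/(axis_lam w) -/(axis_lam t); ring.
  have lE : axis_lam t = axis_lam w by have := ev 0%N; rewrite !expr0 !mul1r.
  by have := ev 1%N; rewrite !expr1 lE => /(mulIf (axis_lam_neq0 dw)).
have [s [s0 _ st _]] := @small_pos R 1 0 (r - cm t) 1 ler01 (lexx _) rt ltr01.
have sC : cm (s%:C : R[i]) = s by rewrite cm_real gtr0_norm.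
have := same (t + s%:C); rewrite [t + _]addrC addrK sC => /(_ _)/eqP.
rewrite mulr1 in st; rewrite st => /(_ isT).
by rewrite -subr_eq0 addrK -cm_eq0 sC gt_eqF.
Qed.

End OnAxis.
End WeakRelation.

Lemma l2_le_mono (R : realType) (a : nat -> R) c (B B' : R) :
  l2_le a c B -> B <= B' -> l2_le a c B'.
Proof.
move=> [B0 cB] BB; have B'0 := le_trans B0 BB; split => // N.
by apply: le_trans (cB N) _; rewrite lerXn2r.
Qed.

Lemma iwc_of_weakly_related (R : realType) (a b : nat -> R)
  (H : hfs R (hardy_domain b 1)) (H' : hfs R (hardy_domain a 1)) :
  weighted_hardy_space H -> weighted_hardy_space H' -> weakly_related H H' ->
  exists lam phi M, iwc b a lam phi M.
Proof.
move=> hH hH' [Lam [Phi [W [hW [T WT TW]]]]].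
have [p pE] := choice (axis_point_exists ord0 hH).
have [M M0 [WM TM]] := wc_bounded hW WT TW.
have Pd := axis_phi_disc hH hH' hW TW pE.
have [E [_ _ Hc cH]] := axis_series ord0 hH.
have [E' [_ _ H'c cH']] := axis_series ord0 hH'.
have PhiE t : val (Phi (p t)) = axis_point ord0 (axis_phi Phi p t) by exact: rV1_axis.
exists (axis_lam Lam p), (axis_phi Phi p), M; split => //.
- move=> c B cB; have [f fB fE] := cH' c B cB; have [c' cB' cE'] := Hc (W f).
  exists c'; first by apply: l2_le_mono cB' _; apply: le_trans (WM f) _; rewrite ler_wpM2l.
  move=> t dt; rewrite -(cE' t (p t) dt (pE t dt)) (wc_eval hW).
  by rewrite (fE _ _ (Pd t dt) (PhiE t)).
- move=> c' B cB; have [h hB hE] := cH c' B cB; have [c cB' cE] := H'c (T h).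
  exists c; first by apply: l2_le_mono cB' _; apply: le_trans (TM h) _; rewrite ler_wpM2l.
  move=> t dt; rewrite -(hE t (p t) dt (pE t dt)) -{1}[h]TW (wc_eval hW).
  by rewrite (cE _ _ (Pd t dt) (PhiE t)).
Qed.

(** The function carried to the $j$-th coordinate vanishes along the image of
    the $i$-th axis.  Its zeros being isolated, this image is a single point near
    the origin, although the $i$-th coordinate is not constant on its axis. *)
Lemma weakly_related_one_variable (R : realType) d (a b : nat -> R)
  (H : hfs R (hardy_domain b d)) (H' : hfs R (hardy_domain a 1)) (i j : 'I_d) :
  weighted_hardy_space H -> weighted_hardy_space H' -> weakly_related H H' ->
  i = j.
Proof.
move=> hH hH' [Lam [Phi [W [hW [T WT TW]]]]]; apply/eqP; apply: contraT => ij.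
have ji : j != i by rewrite eq_sym.
have a0 := wh_gt0 hH'.
have [p pE] := choice (axis_point_exists i hH).
have [s sE] := choice (axis_point_exists j hH).
have [E [Ee _ _ _]] := axis_series i hH.
have [F [Fe Foff _ _]] := axis_series j hH.
have [E' [_ _ H'c _]] := axis_series ord0 hH'.
have d0 := wh_disc0 hH.
have ax0 k : axis_point k 0 = 0 :> 'rV[R[i]]_d.
  by apply/rowP => l; rewrite !mxE if_same.
have ps0 : p 0 = s 0 by apply: val_inj; rewrite pE // sE // !ax0.
pose fp := axis_phi Phi p; pose fs := axis_phi Phi s.
have fps : fs 0 = fp 0 by rewrite /fs /fp /axis_phi ps0.
have Dp t := axis_phi_disc hH hH' hW TW pE (t := t).
have Ds t := axis_phi_disc hH hH' hW TW sE (t := t).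
have Cp := axis_phi_continuous hH hH' hW TW pE d0.
have Cs := axis_phi_continuous hH hH' hW TW sE d0.
rewrite -/fp in Cp; rewrite -/fs fps in Cs.
have PhiE q t : val (Phi (q t)) = axis_point ord0 (axis_phi Phi q t) by exact: rV1_axis.
have [c1 c1B c1E] := H'c (T (E 1%N)).
have [c2 c2B c2E] := H'c (T (F 1%N)).
have e1 t : disc b t -> t = Lam (p t) * ps c1 (fp t).
  move=> dt; rewrite -[LHS]expr1 -(Ee 1%N t (p t) (pE t dt)) -{1}[E 1%N]TW.
  by rewrite (wc_eval hW) (c1E _ _ (Dp t dt) (PhiE p t)).
have e2 t : disc b t -> t = Lam (s t) * ps c2 (fs t).
  move=> dt; rewrite -[LHS]expr1 -(Fe 1%N t (s t) (sE t dt)) -{1}[F 1%N]TW.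
  by rewrite (wc_eval hW) (c2E _ _ (Ds t dt) (PhiE s t)).
have e3 t : disc b t -> ps c2 (fp t) = 0.
  move=> dt; have := Foff i t (p t) ij (pE t dt) 0%N.
  rewrite -{1}[F 1%N]TW (wc_eval hW) (c2E _ _ (Dp t dt) (PhiE p t)) => /eqP.
  have l0 := axis_lam_neq0 hH hW TW pE dt; rewrite /axis_lam in l0.
  by rewrite mulf_eq0 (negbTE l0) => /eqP.
have [r [qr rD [K cK]]] := disc_pbound a0 (Dp 0 d0).
have small (P : set R[i]) : (\forall t \near cnbhs 0, P t) ->
    exists t, [/\ t != 0, disc b t & P t].
  move=> nP; have [e e0 eP] := near_cmp (filterI (disc_near d0) nP).
  have e2' : 0 < e / 2 by rewrite divr_gt0.
  have eC : cm ((e / 2)%:C : R[i]) = e / 2 by rewrite cm_real gtr0_norm.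
  exists (e / 2)%:C; rewrite -cm_eq0 eC gt_eqF //.
  by have [|? ?] := eP (e / 2)%:C; [rewrite subr0 eC; lra|split].
have [[k [g [K' [gK gq gE]]]]|flat] := ps_order_infinite (cK _ _ c2B) qr.
  have near1 : \forall t \near cnbhs 0, fp t = fp 0.
    have n1 : \forall w \near cnbhs (fp 0), ps g w != 0.
      exact: ctends_neq0 gq (ps_continuous gK qr).
    apply: filterS2 (ctends_comp Cp (filterI n1 (near_cm_lt qr))) (disc_near d0).
    move=> t [gt tr] dt.
    have := e3 t dt; rewrite gE // => /eqP; rewrite mulf_eq0 (negbTE gt) orbF.
    by rewrite expf_eq0 subr_eq0 => /andP[_ /eqP].
  have [t [t0 dt ft]] := small _ near1.
  have := e1 0 d0; have := e1 t dt; rewrite ft => et /esym/eqP.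
  have l0 := axis_lam_neq0 hH hW TW pE d0; rewrite /axis_lam in l0.
  rewrite mulf_eq0 (negbTE l0) /= => /eqP E0; move: et.
  by rewrite E0 mulr0 => /eqP; rewrite (negbTE t0).
have rq : 0 < r - cm (fp 0) by rewrite subr_gt0.
have near2 : \forall t \near cnbhs 0, ps c2 (fs t) = 0.
  by apply: filterS (ctends_comp Cs (near_ball (fp 0) rq)) => t /flat.
have [t [t0 dt ft]] := small _ near2.
by have /eqP := e2 t dt; rewrite ft mulr0 (negbTE t0).
Qed.

Theorem theorem7p2 (R : realType) (d : nat) (hd : (0 < d)%N) (a b : nat -> R)
  (H1 : hfs R (hardy_domain a 1)) (H2 : hfs R (hardy_domain b d))
  (hH1 : weighted_hardy_space H1) (hH2 : weighted_hardy_space H2)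
  (h12 : strongly_related H1 H2) :
  exists C c gamma : R, [/\ 0 < C, 0 < c, 0 < gamma &
    forall n : nat, c <= b n / a n * gamma ^+ n <= C].
Proof.
have [w12 w21] := h12.
case: d hd H2 hH2 h12 w12 w21 => [//|[|d]] _ H2 hH2 _ w12 w21; last first.
  by have := weakly_related_one_variable ord0 ord_max hH2 hH1 w21.
have [l1 [f1 [M1 h1]]] := iwc_of_weakly_related hH1 hH2 w12.
have [l2 [f2 [M2 h2]]] := iwc_of_weakly_related hH2 hH1 w21.
exact: (comparable_of_iwc (wh_gt0 hH1) (wh_gt0 hH2) (wh_disc0 hH1) (wh_disc0 hH2) h1 h2).
Qed.
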